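(* Let $F_n$ be the free group with basis $x_1,\dots,x_n$, and let $A\subset\mathrm{Aut}(F_n)$ be the subgroup generated by the automorphisms $\lambda_i$ and $\rho_i$ for $1\le i\le n-1$, where $\lambda_i$ sends $x_i$ to $x_nx_i$ and fixes $x_j$ for $j\ne i$, and $\rho_i$ sends $x_i$ to $x_ix_n$ and fixes $x_j$ for $j\neq i$. Then the inclusion $A\hookrightarrow\mathrm{Aut}(F_n)$ induces the trivial map on rational homology $H_k(A;\mathbb Q)\to H_k(\mathrm{Aut}(F_n);\mathbb Q)$ in all positive dimensions $k>0$.
   Context: The group $A$ is isomorphic to $\mathbb Z^{2n-2}$, a free abelian subgroup of maximal rank in $\mathrm{Aut}(F_n)$ (the virtual cohomological dimension of $\mathrm{Aut}(F_n)$ is $2n-2$); it is called the standard free abelian subgroup of maximal rank. *)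

(* Defs.v *)
From HB Require Import structures.
From mathcomp Require Import all_boot all_order all_algebra.
From mathcomp Require Import monoid boolp finmap monalg zify.

Set Implicit Arguments.
Unset Strict Implicit.
Unset Printing Implicit Defensive.

Import GRing.Theory.

Local Open Scope ring_scope.

Lemma mult_morph1 (G H : groupType) (f : {multiplicative G -> H}) :
  f 1%g = 1%g.
Proof. by apply: (mulgI (f 1%g)); rewrite -gmulfM !mulg1. Qed.

Lemma mult_morphV (G H : groupType) (f : {multiplicative G -> H}) :
  {morph f : g / (g^-1)%g}.
Proof.
by move=> g; apply: (mulgI (f g)); rewrite -gmulfM !mulgV mult_morph1.
Qed.

(* [x] freely generates [F]: the universal property of the free group. *)
Definition is_free_basis (I : Type) (F : groupType) (x : I -> F) : Prop :=
  forall (G : groupType) (y : I -> G),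
    exists f : {multiplicative F -> G},
      (forall i, f (x i) = y i) /\
      (forall f' : {multiplicative F -> G},
         (forall i, f' (x i) = y i) -> f' =1 f).

Lemma free_basis_ext (I : Type) (F : groupType) (x : I -> F) (G : groupType)
    (f f' : {multiplicative F -> G}) :
  is_free_basis x -> (forall i, f (x i) = f' (x i)) -> f =1 f'.
Proof.
move=> /(_ G (fun i => f' (x i)))[g [_ gU]] ff' u.
by rewrite (gU f) // (gU f').
Qed.

Section Automorphisms.
Variable G : groupType.

Record aut := Aut {
  aut_fun :> G -> G;
  aut_inv : G -> G;
  autM : {morph aut_fun : g h / (g * h)%g};
  autK : cancel aut_fun aut_inv;
  autVK : cancel aut_inv aut_fun
}.

HB.instance Definition _ (a : aut) :=
  monoid.isMultiplicative.Build G G (aut_fun a) (@autM a).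

Lemma aut_inj (a b : aut) : a =1 b -> a = b.
Proof.
case: a b => [f f' fM fK f'K] [g g' gM gK g'K] /= /funext fg.
have fg' : f' = g'.
  by apply: funext => u; rewrite -[in RHS](f'K u) fg gK.
case: g / fg gM gK g'K => gM gK g'K; case: g' / fg' gK g'K => gK g'K.
by congr Aut; exact: Prop_irrelevance.
Qed.

HB.instance Definition _ := gen_eqMixin aut.
HB.instance Definition _ := gen_choiceMixin aut.

Definition aut_one : aut :=
  @Aut id id (fun _ _ => erefl) (fun _ => erefl) (fun _ => erefl).

Lemma aut_invM (a : aut) : {morph aut_inv a : g h / (g * h)%g}.
Proof.
by move=> g h; rewrite -[in LHS](autVK a g) -[in LHS](autVK a h) -autM autK.
Qed.

Definition aut_opp (a : aut) : aut :=
  @Aut (aut_inv a) a (@aut_invM a) (@autVK a) (@autK a).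

Lemma aut_compM (a b : aut) : {morph a \o b : g h / (g * h)%g}.
Proof. by move=> g h; rewrite /= !autM. Qed.

Definition aut_mul (a b : aut) : aut :=
  @Aut (a \o b) (aut_inv b \o aut_inv a) (aut_compM a b)
    (can_comp (@autK a) (@autK b)) (can_comp (@autVK b) (@autVK a)).

Fact aut_mulA : associative aut_mul. Proof. by move=> a b c; exact: aut_inj. Qed.
Fact aut_mul1 : left_id aut_one aut_mul. Proof. by move=> a; exact: aut_inj. Qed.
Fact aut_1mul : right_id aut_one aut_mul. Proof. by move=> a; exact: aut_inj. Qed.
Fact aut_mulV : left_inverse aut_one aut_opp aut_mul.
Proof. by move=> a; apply: aut_inj => g /=; rewrite autK. Qed.
Fact aut_Vmul : right_inverse aut_one aut_opp aut_mul.
Proof. by move=> a; apply: aut_inj => g /=; rewrite autVK. Qed.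

HB.instance Definition _ :=
  isGroup.Build aut aut_mulA aut_mul1 aut_1mul aut_mulV aut_Vmul.

End Automorphisms.

Section Generated.
Variables (G : groupType) (S : G -> Prop).

Definition generated : {pred G} := [pred g | `[<
  forall H : {pred G}, group_closed H -> (forall s, S s -> s \in H) ->
    g \in H >]].

Fact generated_closed : group_closed generated.
Proof.
split=> [|g h]; rewrite !inE; first by apply/asboolP => H [].
move=> /asboolP gS /asboolP hS; apply/asboolP => H Hgrp SH.
by apply: Hgrp.2; [exact: gS|exact: hS].
Qed.

(* The subgroup <S>, as a group in its own right, with inclusion [gen_incl]. *)
Definition gen_group : Type := {g : G | g \in generated}.

HB.instance Definition _ := SubChoice.on gen_group.
HB.instance Definition _ :=
  SubChoice_isSubGroup.Build G generated gen_group generated_closed.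

Definition gen_incl : {multiplicative gen_group -> G} :=
  [the {multiplicative _ -> _} of (val : gen_group -> G)].

End Generated.

Section LinearExtension.
Variables (K : choiceType) (V : lmodType rat) (f : K -> V).

Definition linext (c : {malg rat[K]}) : V := \sum_(k <- msupp c) c@_k *: f k.

Lemma linextEw (D : {fset K}) c : (msupp c `<=` D)%fset ->
  linext c = \sum_(k <- D) c@_k *: f k.
Proof.
move=> cD; rewrite /linext; apply: big_fset_incl => // k _ kc.
by rewrite mcoeff_outdom // scale0r.
Qed.

Fact linext_is_linear : linear linext.
Proof.
move=> a c d; pose D := (msupp (a *: c + d) `|` (msupp c `|` msupp d))%fset.
rewrite !(@linextEw D) ?fsubsetUl ?fsubsetUr //.
- rewrite scaler_sumr -big_split /=; apply: eq_bigr => k _.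
  by rewrite mcoeffD mcoeffZ scalerDl scalerA.
- by rewrite /D fsetUA fsubsetUr.
- by rewrite /D fsetUCA fsubsetUl.
Qed.

HB.instance Definition _ :=
  GRing.isLinear.Build rat {malg rat[K]} V *:%R linext linext_is_linear.

Lemma linextU k : linext << k >> = f k.
Proof.
rewrite (@linextEw [fset k]%fset) ?msuppU_le // big_seq_fset1.
by rewrite mcoeffUU scale1r.
Qed.

End LinearExtension.

Section Homology.
Variable G : groupType.

(* The [i]-th face (0 <= i <= k.+1) of a bar-complex simplex [g_1|...|g_k.+1]:
   drop [g_1] if [i = 0], drop [g_k.+1] if [i = k.+1], and otherwise replace
   [g_i, g_i+1] by their product.  Indices below start at 0. *)
Definition face k (i : nat) (g : {ffun 'I_k.+1 -> G}) : {ffun 'I_k -> G} :=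
  [ffun j : 'I_k =>
    if (j.+1 < i)%N then g (widen_ord (leqnSn k) j)
    else if j.+1 == i then (g (widen_ord (leqnSn k) j) * g (lift ord0 j))%g
    else g (lift ord0 j)].

(* Inhomogeneous bar complex with trivial rational coefficients. *)
Definition chain k := {malg rat[{ffun 'I_k -> G}]}.

Definition bdry k : chain k.+1 -> chain k :=
  linext (fun g => \sum_(i < k.+2) (-1) ^+ i *: << face i g >>).

Fact bdry_is_linear k : linear (@bdry k).
Proof. exact: linext_is_linear. Qed.

HB.instance Definition _ k :=
  GRing.isLinear.Build rat (chain k.+1) (chain k) *:%R (@bdry k)
    (@bdry_is_linear k).

Lemma face_face k (i j : nat) (g : {ffun 'I_k.+2 -> G}) : (i < j)%N ->
  face i (face j g) = face j.-1 (face i g).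
Proof.
case: j => // j; rewrite ltnS /= => le_ij; apply/ffunP => u; rewrite !ffunE /=.
have -> : lift ord0 (widen_ord (leqnSn k) u) =
          widen_ord (leqnSn k.+1) (lift ord0 u).
  exact: val_inj.
rewrite /bump leq0n !add1n; move: (g _) (g _) (g _) => x y z.
by do ![case: ifP => ? //]; rewrite ?mulgA //; lia.
Qed.

Lemma bdryK k (c : chain k.+2) : bdry (bdry c) = 0.
Proof.
have -> : bdry c = \sum_(g <- msupp c) c@_g *:
    \sum_(j < k.+3) (-1) ^+ j *: << face j g >> by [].
rewrite (linear_sum (@bdry k)) big1 //= => g _.
rewrite linearZ /= (linear_sum (@bdry k)) /=.
pose t (p : 'I_k.+3 * 'I_k.+2) : chain k :=
  (-1) ^+ (p.1 + p.2) *: << face p.2 (face p.1 g) >>.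
rewrite (eq_bigr (fun j => \sum_(i < k.+2) t (j, i))); last first.
  move=> j _; rewrite linearZ /= /bdry linextU scaler_sumr.
  by apply: eq_bigr => i _; rewrite scalerA -exprD.
rewrite (pair_bigA _ (fun j i => t (j, i))) /=.
have -> : \sum_p t (p.1, p.2) = 0; last by rewrite scaler0.
pose s (p : 'I_k.+3 * 'I_k.+2) : 'I_k.+3 * 'I_k.+2 :=
  if (p.2 < p.1)%N then (inord p.2, inord p.1.-1)
  else (inord p.2.+1, inord p.1).
have sK : involutive s.
  move=> [[j lj] [i li]]; rewrite /s /=.
  by case: (ltnP i j) => ij /=; rewrite !inordK /=; try lia; case: ifP => /= ?;
     try lia; congr (_, _); apply: val_inj; rewrite /= !inordK //=; lia.
have ts p : t (s p) = - t p.
  case: p => [[j lj] [i li]]; rewrite /s /t /=.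
  case: (ltnP i j) => ij /=; rewrite !inordK /=; try lia.
    rewrite -face_face //; case: j lj ij => // j _ _ /=.
    by rewrite addSn exprS mulN1r scaleNr opprK addnC.
  rewrite (@face_face k j i.+1) //=.
  by rewrite addSn exprS mulN1r scaleNr addnC.
have S2 : \sum_p t (p.1, p.2) = - \sum_p t (p.1, p.2).
  rewrite {1}(reindex_inj (inv_inj sK)) /= -sumrN; apply: eq_bigr => p _.
  by rewrite -!surjective_pairing ts.
move: S2 => /eqP; rewrite -addr_eq0 -mulr2n -scaler_nat scaler_eq0.
by move=> /orP[//|/eqP].
Qed.

Definition cycle k : {pred chain k} :=
  if k is j.+1 then fun c : chain j.+1 => bdry c == 0 else predT.

Fact cycle_submod_closed k : submod_closed (@cycle k).
Proof.
case: k => [|k]; first by split.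
split=> [|a c d]; first by rewrite unfold_in /= linear0.
by rewrite !unfold_in /= linearP /= => /eqP-> /eqP->; rewrite scaler0 addr0.
Qed.

Definition cycles k : Type := {c : chain k | c \in @cycle k}.

HB.instance Definition _ k := SubChoice.on (cycles k).
HB.instance Definition _ k :=
  GRing.SubChoice_isSubLmodule.Build rat (chain k) (@cycle k) (cycles k)
    (cycle_submod_closed k).

Definition boundary k : {pred cycles k} :=
  fun z => `[< exists b : chain k.+1, val z = bdry b >].

Fact boundary_submod_closed k : submod_closed (@boundary k).
Proof.
split=> [|a y z]; rewrite !unfold_in.
  by apply/asboolP; exists 0; rewrite !linear0.
move=> /asboolP[b yb] /asboolP[c zc]; apply/asboolP; exists (a *: b + c).
by rewrite !linearP /= yb zc.
Qed.

HB.instance Definition _ k :=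
  GRing.isZmodClosed.Build (cycles k) (@boundary k)
    (GRing.submod_closedB (boundary_submod_closed k)).

Lemma bdry_cycle k (b : chain k.+1) : bdry b \in @cycle k.
Proof. by case: k b => [|k] b //; rewrite unfold_in /= bdryK. Qed.

(* H_k(G; Q): by [bdry_cycle], all boundaries are cycles. *)
Definition homology k : Type := Quotient.quot (@boundary k).

HB.instance Definition _ k := EqQuotient.on (homology k).
HB.instance Definition _ k := GRing.Zmodule.on (homology k).

Definition hclass k (z : cycles k) : homology k := (\pi z)%qT.

Lemma hclass_eq k (y z : cycles k) :
  (hclass y == hclass z) = (y - z \in @boundary k).
Proof. by rewrite Quotient.idealrBE. Qed.

Lemma hclass_surj k (h : homology k) : exists z, hclass z = h.
Proof. by exists (repr h); rewrite /hclass reprK. Qed.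

Fact hclass_is_additive k : zmod_morphism (@hclass k).
Proof. by move=> y z; rewrite /hclass !piE. Qed.

HB.instance Definition _ k :=
  GRing.isZmodMorphism.Build (cycles k) (homology k) (@hclass k)
    (@hclass_is_additive k).

Lemma hclass_eq0 k (z : cycles k) : (hclass z == 0) = (z \in @boundary k).
Proof. by rewrite -(raddf0 (@hclass k)) hclass_eq subr0. Qed.

Definition hscale k (a : rat) (h : homology k) : homology k :=
  hclass (a *: repr h).

Lemma hscale_class k a (z : cycles k) : hscale a (hclass z) = hclass (a *: z).
Proof.
apply/eqP; rewrite hclass_eq -scalerBr.
have: repr (hclass z) - z \in @boundary k by rewrite -hclass_eq /hclass reprK.
have [b0 bL] := boundary_submod_closed k.
by move=> zB; rewrite -[X in X \in _]addr0; apply: bL.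
Qed.

Fact hscaleA k a b (h : homology k) : hscale a (hscale b h) = hscale (a * b) h.
Proof. by case: (hclass_surj h) => z <-; rewrite !hscale_class scalerA. Qed.
Fact hscale1 k : left_id 1 (@hscale k).
Proof. by move=> h; case: (hclass_surj h) => z <-; rewrite hscale_class scale1r. Qed.
Fact hscaleDr k : right_distributive (@hscale k) +%R.
Proof.
move=> a h h'; case: (hclass_surj h) (hclass_surj h') => y <- [z <-].
by rewrite -raddfD !hscale_class scalerDr raddfD.
Qed.
Fact hscaleDl k (h : homology k) : {morph (@hscale k)^~ h : a b / a + b}.
Proof.
by move=> a b; case: (hclass_surj h) => z <-; rewrite !hscale_class scalerDl raddfD.
Qed.

HB.instance Definition _ k :=
  GRing.Zmodule_isLmodule.Build rat (homology k)
    (@hscaleA k) (@hscale1 k) (@hscaleDr k) (@hscaleDl k).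

Fact hclass_is_scalable k : scalable (@hclass k).
Proof. by move=> a z; rewrite -hscale_class. Qed.

HB.instance Definition _ k :=
  GRing.isScalable.Build rat (cycles k) (homology k) *:%R (@hclass k)
    (@hclass_is_scalable k).

End Homology.

Section InducedMap.
Variables (G H : groupType) (f : {multiplicative G -> H}).

Definition push k : chain G k -> chain H k :=
 linext (fun g : {ffun 'I_k -> G} => << [ffun j => f (g j)] >>).

Fact push_is_linear k : linear (@push k).
Proof. exact: linext_is_linear. Qed.

HB.instance Definition _ k :=
  GRing.isLinear.Build rat (chain G k) (chain H k) *:%R (@push k)
    (@push_is_linear k).

Lemma bdry_push k (c : chain G k.+1) : bdry (push c) = push (bdry c).
Proof.
have -> : push c = \sum_(g <- msupp c) c@_g *: << [ffun j => f (g j)] >> by [].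
have -> : bdry c = \sum_(g <- msupp c) c@_g *:
    \sum_(i < k.+2) (-1) ^+ i *: << face i g >> by [].
rewrite (linear_sum (@bdry _ k)) (linear_sum (@push k)); apply: eq_bigr => g _.
rewrite !linearZ /=; congr (_ *: _); rewrite (linear_sum (@push k)) /bdry linextU.
apply: eq_bigr => i _; rewrite linearZ /= /push linextU; congr (_ *: << _ >>).
by apply/ffunP => j; rewrite !ffunE; do 2?case: ifP => _ //; rewrite gmulfM.
Qed.

Lemma push_cycle k (c : chain G k) : c \in @cycle G k -> push c \in @cycle H k.
Proof.
case: k c => [|k] c //; rewrite !unfold_in /= => /eqP c0.
by rewrite bdry_push c0 linear0.
Qed.

Definition push_cycles k (z : cycles G k) : cycles H k :=
  Sub (push (val z)) (push_cycle (valP z)).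

(* The induced map H_k(G; Q) -> H_k(H; Q); [hmap_class] shows that it does not
   depend on the representative. *)
Definition hmap k (h : homology G k) : homology H k :=
  hclass (push_cycles (repr h)).

Lemma hmap_class k (z : cycles G k) : hmap (hclass z) = hclass (push_cycles z).
Proof.
apply/eqP; rewrite hclass_eq.
have: repr (hclass z) - z \in @boundary G k by rewrite -hclass_eq /hclass reprK.
rewrite !unfold_in => /asboolP[b zb]; apply/asboolP; exists (push b).
by rewrite bdry_push -zb !linearB.
Qed.

Fact hmap_is_linear k : linear (@hmap k).
Proof.
move=> a h h'; case: (hclass_surj h) (hclass_surj h') => y <- [z <-].
rewrite -linearP !hmap_class -linearP; congr hclass.
by apply: val_inj; rewrite /= !linearP.
Qed.

HB.instance Definition _ k :=
  GRing.isLinear.Build rat (homology G k) (homology H k) *:%R (@hmap k)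
    (@hmap_is_linear k).

End InducedMap.

(* The free group has rank [n.+1] here: its basis is [x 0, ..., x n], and
   [x ord_max] is the distinguished last basis element.  The automorphisms
   lambda_i and rho_i are specified by their values on the basis; see
   [lambda_unique] and [rho_unique] for existence and uniqueness. *)
Section StandardAbelian.
Variables (n : nat) (F : groupType) (x : 'I_n.+1 -> F).

Definition is_lambda (i : 'I_n.+1) (a : aut F) : Prop :=
  a (x i) = (x ord_max * x i)%g /\ forall j, j != i -> a (x j) = x j.

Definition is_rho (i : 'I_n.+1) (a : aut F) : Prop :=
  a (x i) = (x i * x ord_max)%g /\ forall j, j != i -> a (x j) = x j.

Lemma free_basis_aut (y z : 'I_n.+1 -> F) :
  is_free_basis x ->
  (forall f : {multiplicative F -> F}, (forall j, f (x j) = y j) ->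
     forall j, f (z j) = x j) ->
  (forall f : {multiplicative F -> F}, (forall j, f (x j) = z j) ->
     forall j, f (y j) = x j) ->
  exists! a : aut F, forall j, a (x j) = y j.
Proof.
move=> Fx yz zy; have [f [fy _]] := Fx F y; have [g [gz _]] := Fx F z.
pose id1 : {multiplicative F -> F} := [the {multiplicative _ -> _} of idfun].
have gfK : cancel f g.
  pose gf : {multiplicative F -> F} := [the {multiplicative _ -> _} of g \o f].
  have H : forall j, gf (x j) = id1 (x j) by move=> j /=; rewrite fy zy.
  exact: (free_basis_ext Fx H).
have fgK : cancel g f.
  pose fg : {multiplicative F -> F} := [the {multiplicative _ -> _} of f \o g].
  have H : forall j, fg (x j) = id1 (x j) by move=> j /=; rewrite gz yz.
  exact: (free_basis_ext Fx H).
exists (Aut (@gmulfM _ _ f) gfK fgK); split=> // b bE; apply: aut_inj => u.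
have H : forall j, b (x j) = f (x j) by move=> j; rewrite bE fy.
exact/esym/(free_basis_ext Fx H).
Qed.

Lemma lambda_unique i : is_free_basis x -> i != ord_max ->
  exists! a, is_lambda i a.
Proof.
move=> Fx ni; have nmax : (ord_max == i) = false by rewrite eq_sym (negPf ni).
pose y j := if j == i then (x ord_max * x i)%g else x j.
pose z j := if j == i then ((x ord_max)^-1 * x i)%g else x j.
have [||a [aE aU]] := @free_basis_aut y z Fx.
- move=> f fy j; rewrite /z; case: eqP => [->|/eqP/negPf ji].
    by rewrite gmulfM mult_morphV !fy /y eqxx nmax mulKg.
  by rewrite fy /y ji.
- move=> f fz j; rewrite /y; case: eqP => [->|/eqP/negPf ji].
    by rewrite gmulfM !fz /z eqxx nmax mulVKg.
  by rewrite fz /z ji.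
exists a; split.
  by split=> [|j /negPf ji]; rewrite aE /y ?eqxx ?ji.
by move=> b [bi bj]; apply: aU => j; rewrite /y; case: eqP => [->|/eqP/bj].
Qed.

Lemma rho_unique i : is_free_basis x -> i != ord_max -> exists! a, is_rho i a.
Proof.
move=> Fx ni; have nmax : (ord_max == i) = false by rewrite eq_sym (negPf ni).
pose y j := if j == i then (x i * x ord_max)%g else x j.
pose z j := if j == i then (x i * (x ord_max)^-1)%g else x j.
have [||a [aE aU]] := @free_basis_aut y z Fx.
- move=> f fy j; rewrite /z; case: eqP => [->|/eqP/negPf ji].
    by rewrite gmulfM mult_morphV !fy /y eqxx nmax mulgK.
  by rewrite fy /y ji.
- move=> f fz j; rewrite /y; case: eqP => [->|/eqP/negPf ji].
    by rewrite gmulfM !fz /z eqxx nmax mulgVK.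
  by rewrite fz /z ji.
exists a; split.
  by split=> [|j /negPf ji]; rewrite aE /y ?eqxx ?ji.
by move=> b [bi bj]; apply: aU => j; rewrite /y; case: eqP => [->|/eqP/bj].
Qed.

Definition std_gens (a : aut F) : Prop :=
  exists2 i : 'I_n.+1, i != ord_max & is_lambda i a \/ is_rho i a.

Definition std_abelian : Type := gen_group std_gens.

HB.instance Definition _ := Group.on std_abelian.

Definition std_incl : {multiplicative std_abelian -> aut F} := gen_incl std_gens.

End StandardAbelian.

(* Main.v *)
(* Conjugation acts trivially on the homology of Aut(F_n).  The group A is free
   abelian on the lambda_i, rho_i, so its rational homology is spanned by
   Pontryagin products of these generators, i.e. by exterior monomials.
   - x_i -> x_i^-1 conjugates lambda_i to rho_i^-1 and rho_i to lambda_i^-1 and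
     fixes the other generators.  Hence a monomial lambda_i rho_i w equals
     rho_i lambda_i w = - lambda_i rho_i w in the homology of Aut(F_n), and in a
     monomial involving only one of them rho_i may be replaced by - lambda_i.
   - Exchanging x_i and x_j gives
     lambda_i lambda_j w = lambda_j lambda_i w = - lambda_i lambda_j w.
   - x_n -> x_n^-1 inverts every generator, which kills the monomials of
     degree 1. *)
Require Import Defs.
From HB Require Import structures.
From mathcomp Require Import all_boot all_order all_algebra.
From mathcomp Require Import monoid boolp finmap monalg zify ring.

Set Implicit Arguments.
Unset Strict Implicit.
Unset Printing Implicit Defensive.

Import GRing.Theory.

Local Open Scope ring_scope.

(** * The bar complex on lists of arbitrary length *)

(** That products of generators span the homology is proved with explicit homotopies, for any
    abelian group with integer coordinates dual to a finite family. A coordinate [q] with dual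
    element [t] splits off a factor Z: up to boundaries, a cycle [z] is its projection to the kernel
    of [q] plus the product of [t] with the slant product of [z] and [q], which has lower degree.
    Induction on the degree and on the coordinates leaves only products of generators. The
    coordinates on A are the exponents p, r in x_i -> x_n^p x_i x_n^r; a quotient of the free group
    shows that they are well defined. In a complex graded by functions on ['I_k], every homotopy
    would reindex its arguments. The computations therefore take place in one module on lists of all
    lengths, by recursion on the first letter. The face that drops this letter does not fit the
    recursion, so the boundary is split into this face and the rest. Homogeneous components are
    taken only at the end. *)

Lemma malg_lin_ext (K : choiceType) (V : lmodType rat)
    (f g : {linear {malg rat[K]} -> V}) :
  (forall k, f << k >> = g << k >>) -> f =1 g.
Proof.
move=> fg c; rewrite [c]monalgE !linear_sum; apply: eq_bigr => k _.
have -> : << c@_k *g k >> = c@_k *: << k >> :> {malg rat[K]}.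
  by apply/malgP => j; rewrite mcoeffZ !mcoeffU mulrnAr mulr1.
by rewrite !linearZ fg.
Qed.

(* Additive identities between chains are checked coefficientwise with [ring],
   after abstracting the subterms that are not sums. *)
Ltac gen_atoms t :=
  lazymatch t with
  | @GRing.add _ ?a ?b => gen_atoms a; gen_atoms b
  | @GRing.opp _ ?a => gen_atoms a
  | @GRing.scale _ _ _ ?a => gen_atoms a
  | @GRing.zero _ => idtac
  | _ => tryif is_var t then idtac else (move: t => ?)
  end.
Ltac chain_ring :=
  lazymatch goal with |- ?a = _ => gen_atoms a end;
  lazymatch goal with |- _ = ?b => gen_atoms b end;
  apply/malgP => ?;
  rewrite ?(mcoeffD, mcoeffN, mcoeffZ, mcoeff0); ring.

Notation bar G := {malg rat[seq G]}.

(* The operators are locked, otherwise failing unifications unfold [linext]. *)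
HB.lock Definition cons_ch (G : groupType) (x : G) : bar G -> bar G :=
  linext (fun s => << x :: s >>).
Fact cons_ch_linear (G : groupType) (x : G) : linear (cons_ch x).
Proof. by rewrite cons_ch.unlock; exact: linext_is_linear. Qed.
HB.instance Definition _ (G : groupType) (x : G) :=
  GRing.isLinear.Build rat (bar G) (bar G) *:%R (cons_ch x)
    (cons_ch_linear x).

Definition mul_head_seq (G : groupType) (x : G) (s : seq G) : seq G :=
  if s is y :: s' then (x * y)%g :: s' else [::].

HB.lock Definition mul_head (G : groupType) (x : G) : bar G -> bar G :=
  linext (fun s => << mul_head_seq x s >>).
Fact mul_head_linear (G : groupType) (x : G) : linear (mul_head x).
Proof. by rewrite mul_head.unlock; exact: linext_is_linear. Qed.
HB.instance Definition _ (G : groupType) (x : G) :=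
  GRing.isLinear.Build rat (bar G) (bar G) *:%R (mul_head x)
    (mul_head_linear x).

HB.lock Definition tail_ch (G : groupType) : bar G -> bar G :=
  linext (fun s => if s is _ :: s' then << s' >> else 0).
Fact tail_ch_linear (G : groupType) : linear (@tail_ch G).
Proof. by rewrite tail_ch.unlock; exact: linext_is_linear. Qed.
HB.instance Definition _ (G : groupType) :=
  GRing.isLinear.Build rat (bar G) (bar G) *:%R (@tail_ch G)
    (@tail_ch_linear G).

(* [inner_bd] is the alternating sum of all faces but the first one, beginning
   with [x_1 x_2|x_3|...]; the face dropping the last entry comes from
   [mul_head_seq x [::] = [::]].  Most operators below satisfy one identity with
   [tail_ch] and one with [inner_bd], each by induction on lists. *)
Fixpoint inner_bd_seq (G : groupType) (s : seq G) : bar G :=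
  if s is x :: s' then
    << mul_head_seq x s' >> - cons_ch x (inner_bd_seq s')
  else 0.

HB.lock Definition inner_bd (G : groupType) : bar G -> bar G :=
  linext (@inner_bd_seq G).
Fact inner_bd_linear (G : groupType) : linear (@inner_bd G).
Proof. by rewrite inner_bd.unlock; exact: linext_is_linear. Qed.
HB.instance Definition _ (G : groupType) :=
  GRing.isLinear.Build rat (bar G) (bar G) *:%R (@inner_bd G)
    (@inner_bd_linear G).

Definition bd (G : groupType) (c : bar G) := tail_ch c - inner_bd c.
HB.instance Definition _ (G : groupType) :=
  GRing.Linear.copy (@bd G) (@tail_ch G \- @inner_bd G).

HB.lock Definition pushs (G H : groupType) (f : G -> H) : bar G -> bar H :=
  linext (fun s => << map f s >>).
Fact pushs_linear (G H : groupType) (f : G -> H) : linear (pushs f).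
Proof. by rewrite pushs.unlock; exact: linext_is_linear. Qed.
HB.instance Definition _ (G H : groupType) (f : G -> H) :=
  GRing.isLinear.Build rat (bar G) (bar H) *:%R (pushs f)
    (pushs_linear f).

(* [g_1|...|g_k] is sent to the alternating sum of the
   [f g_1|...|f g_i|a|f' g_(i+1)|...|f' g_k]. *)
Fixpoint prism_seq (G H : groupType) (f f' : G -> H) (a : H) (s : seq G) :
    bar H :=
  if s is x :: s' then
    << a :: map f' s >> - cons_ch (f x) (prism_seq f f' a s')
  else << [:: a] >>.

HB.lock Definition prism (G H : groupType) (f f' : G -> H) (a : H) :
    bar G -> bar H :=
  linext (prism_seq f f' a).
Fact prism_linear (G H : groupType) (f f' : G -> H) (a : H) :
  linear (prism f f' a).
Proof. by rewrite prism.unlock; exact: linext_is_linear. Qed.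
HB.instance Definition _ (G H : groupType) (f f' : G -> H) (a : H) :=
  GRing.isLinear.Build rat (bar G) (bar H) *:%R (prism f f' a)
    (prism_linear f f' a).

Section BarComplex.
Variable G : groupType.
Local Notation C := (bar G).
Implicit Types (a g h t x y : G) (s : seq G) (c : C).

Lemma cons_chB x : {morph cons_ch x : c d / c - d}.
Proof. exact: linearB. Qed.
Lemma cons_chD x : {morph cons_ch x : c d / c + d}.
Proof. exact: linearD. Qed.
Lemma mul_headB x : {morph mul_head x : c d / c - d}.
Proof. exact: linearB. Qed.
Lemma inner_bdB : {morph @inner_bd G : c d / c - d}.
Proof. exact: linearB. Qed.
Lemma tailB : {morph @tail_ch G : c d / c - d}.
Proof. exact: linearB. Qed.

Lemma cons_chU x s : cons_ch x << s >> = << x :: s >>.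
Proof. by rewrite cons_ch.unlock linextU. Qed.
Lemma mul_headU x s : mul_head x << s >> = << mul_head_seq x s >>.
Proof. by rewrite mul_head.unlock linextU. Qed.

Lemma bdE c : bd c = tail_ch c - inner_bd c. Proof. by []. Qed.

Lemma inner_bd_nil : inner_bd (<< [::] >> : C) = 0.
Proof. by rewrite inner_bd.unlock linextU. Qed.

Lemma tail_nil : tail_ch (<< [::] >> : C) = 0.
Proof. by rewrite tail_ch.unlock linextU. Qed.

Lemma mul_head_nil x : mul_head x << [::] >> = << [::] >>.
Proof. by rewrite mul_head.unlock linextU. Qed.

(** The step is stated with [cons_ch] instead of [x :: s], so that the rules for operators applied
    to [cons_ch] rewrite it directly. *)
Lemma bar_ext (V : lmodType rat) (f g : {linear C -> V}) :
  f << [::] >> = g << [::] >> ->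
  (forall x s, f << s >> = g << s >> ->
     f (cons_ch x << s >>) = g (cons_ch x << s >>)) ->
  f =1 g.
Proof.
move=> fg0 fgS; apply: malg_lin_ext; elim=> [//|x s IHs].
by rewrite -cons_chU fgS.
Qed.

Lemma inner_bd_cons x c :
  inner_bd (cons_ch x c) = mul_head x c - cons_ch x (inner_bd c).
Proof.
apply: (malg_lin_ext (f := @inner_bd G \o cons_ch x)
  (g := mul_head x \- (cons_ch x \o @inner_bd G))).
by move=> s; rewrite /= cons_chU inner_bd.unlock mul_headU !linextU.
Qed.

Lemma tail_cons x c : tail_ch (cons_ch x c) = c.
Proof.
apply: (malg_lin_ext (f := @tail_ch G \o cons_ch x) (g := idfun)).
by move=> s; rewrite /= cons_chU tail_ch.unlock linextU.
Qed.

Lemma mul_head_cons x y c : mul_head x (cons_ch y c) = cons_ch (x * y)%g c.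
Proof.
apply: (malg_lin_ext (f := mul_head x \o cons_ch y) (g := cons_ch (x * y)%g)).
by move=> s; rewrite /= !cons_chU mul_headU.
Qed.

Lemma mul_head1 c : mul_head 1%g c = c.
Proof.
apply: (malg_lin_ext (f := mul_head 1%g) (g := idfun)) => -[|y s] /=.
  by rewrite mul_head_nil.
by rewrite mul_headU /= mul1g.
Qed.

Lemma bd_nil : bd (<< [::] >> : C) = 0.
Proof. by rewrite bdE tail_nil inner_bd_nil subr0. Qed.

Lemma bd_cons x c :
  bd (cons_ch x c) = c - mul_head x c + cons_ch x (inner_bd c).
Proof. by rewrite bdE tail_cons inner_bd_cons opprB addrA addrAC. Qed.

End BarComplex.

(** * Functoriality of the bar complex and homotopies given by conjugation *)

Section Prism.
Variables G H : groupType.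

Lemma pushsB (f : G -> H) : {morph pushs f : c d / c - d}.
Proof. exact: linearB. Qed.

Lemma pushsU (f : G -> H) s : pushs f << s >> = << map f s >>.
Proof. by rewrite pushs.unlock linextU. Qed.

Lemma pushs_nil (f : G -> H) : pushs f (<< [::] >> : bar G) = << [::] >>.
Proof. exact: pushsU. Qed.

Lemma pushs_cons (f : G -> H) x c :
  pushs f (cons_ch x c) = cons_ch (f x) (pushs f c).
Proof.
apply: (malg_lin_ext (f := pushs f \o cons_ch x)
  (g := cons_ch (f x) \o pushs f)).
by move=> s; rewrite /= cons_chU !pushsU cons_chU.
Qed.

Lemma pushs_tail (f : G -> H) c : pushs f (tail_ch c) = tail_ch (pushs f c).
Proof.
apply: (bar_ext (f := pushs f \o @tail_ch G) (g := @tail_ch H \o pushs f)).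
  by rewrite /= pushs_nil !tail_nil linear0.
by move=> x s _ /=; rewrite pushs_cons !tail_cons.
Qed.

Section Morphism.
Variable f : G -> H.
Hypothesis fM : {morph f : x y / (x * y)%g}.

Lemma pushs_mul_head x c : pushs f (mul_head x c) = mul_head (f x) (pushs f c).
Proof.
apply: (bar_ext (f := pushs f \o mul_head x) (g := mul_head (f x) \o pushs f)).
  by rewrite /= mul_head_nil !pushs_nil mul_head_nil.
by move=> y s _ /=; rewrite mul_head_cons !pushs_cons mul_head_cons fM.
Qed.

Lemma pushs_inner_bd c : pushs f (inner_bd c) = inner_bd (pushs f c).
Proof.
apply: (bar_ext (f := pushs f \o @inner_bd G) (g := @inner_bd H \o pushs f)).
  by rewrite /= pushs_nil !inner_bd_nil linear0.
move=> x s /= IHs.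
rewrite inner_bd_cons pushs_cons inner_bd_cons pushsB pushs_mul_head.
by rewrite pushs_cons IHs.
Qed.

Lemma pushs_bd c : pushs f (bd c) = bd (pushs f c).
Proof. by rewrite !bdE pushsB pushs_tail pushs_inner_bd. Qed.

End Morphism.

Section Homotopy.
Variables (f f' : G -> H) (a : H).

Local Notation prism := (prism f f' a).

Lemma prismB : {morph prism : c d / c - d}.
Proof. exact: linearB. Qed.

Lemma prism_nil : prism (<< [::] >> : bar G) = cons_ch a << [::] >>.
Proof. by rewrite cons_chU prism.unlock linextU. Qed.

Lemma prism_cons x c :
  prism (cons_ch x c) =
    cons_ch a (cons_ch (f' x) (pushs f' c)) - cons_ch (f x) (prism c).
Proof.
apply: (malg_lin_ext (f := prism \o cons_ch x)
  (g := (cons_ch a \o cons_ch (f' x) \o pushs f') \- (cons_ch (f x) \o prism))).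
by move=> s; rewrite /= cons_chU pushsU prism.unlock !linextU /= !cons_chU.
Qed.

Lemma prism_tail c : tail_ch (prism c) + prism (tail_ch c) = pushs f' c.
Proof.
apply: (bar_ext (f := (@tail_ch H \o prism) \+ (prism \o @tail_ch G))
  (g := pushs f')) => [|x s _] /=.
  by rewrite prism_nil tail_cons tail_nil linear0 addr0 pushs_nil.
by rewrite prism_cons tailB !tail_cons pushs_cons subrK.
Qed.

Hypothesis fM : {morph f : x y / (x * y)%g}.
Hypothesis f'M : {morph f' : x y / (x * y)%g}.
Hypothesis afE : forall x, (f x * a = a * f' x)%g.

(** In the summand that begins with [a], [mul_head (f x)] multiplies [a] itself; the last two terms
    correct this. *)
Lemma prism_mul_head x c : prism (mul_head x c) = mul_head (f x) (prism c) +
  cons_ch a (pushs f' (mul_head x c)) - cons_ch (f x * a)%g (pushs f' c).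
Proof.
apply: (bar_ext (f := prism \o mul_head x) (g := (mul_head (f x) \o prism) \+
  (cons_ch a \o pushs f' \o mul_head x) \- (cons_ch (f x * a)%g \o pushs f'))).
  rewrite /= mul_head_nil pushs_nil prism_nil mul_head_cons.
  by rewrite addrAC subrr add0r.
move=> y s _ /=.
rewrite !mul_head_cons !prism_cons !pushs_cons !mul_headB !mul_head_cons fM.
by chain_ring.
Qed.

(** By [afE] the faces that merge [a] with a neighbour cancel between consecutive summands; the face
    that drops a final [a] survives. *)
Lemma prism_inner_bd c : inner_bd (prism c) + prism (inner_bd c) = pushs f c.
Proof.
apply: (bar_ext (f := (@inner_bd H \o prism) \+ (prism \o @inner_bd G))
  (g := pushs f)).
  rewrite /= prism_nil inner_bd_cons !inner_bd_nil !linear0 mul_head_nil.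
  by rewrite pushs_nil !addr0.
move=> x s /= IHs.
rewrite prism_cons !inner_bd_cons inner_bdB !inner_bd_cons prismB.
rewrite prism_mul_head prism_cons (pushs_mul_head f'M) !mul_head_cons.
rewrite -(pushs_inner_bd f'M) afE pushs_cons -IHs !cons_chB cons_chD.
by chain_ring.
Qed.

(** By [afE], [a] is a natural transformation between [f] and [f'], viewed as functors of one-object
    categories; this is the induced chain homotopy. *)
Lemma prism_bd c : bd (prism c) + prism (bd c) = pushs f' c - pushs f c.
Proof. by rewrite -prism_tail -prism_inner_bd !bdE prismB; chain_ring. Qed.

End Homotopy.
End Prism.

(** * Pontryagin products with a group element *)

Section Insertion.
Variable G : groupType.
Implicit Types (t g h x : G) (s : seq G) (c : bar G).

Lemma pushs_id c : pushs idfun c = c.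
Proof.
apply: (malg_lin_ext (f := pushs idfun) (g := idfun)) => s /=.
by rewrite pushsU map_id.
Qed.

(* For central [t], the shuffle product with the 1-cycle [t]. *)
Definition ins t c := prism idfun idfun t c.
HB.instance Definition _ t := GRing.Linear.copy (ins t) (prism idfun idfun t).

Lemma insB t : {morph ins t : c d / c - d}.
Proof. exact: linearB. Qed.

Lemma ins_nil t : ins t << [::] >> = cons_ch t << [::] >>.
Proof. exact: prism_nil. Qed.

Lemma ins_cons t x c :
  ins t (cons_ch x c) = cons_ch t (cons_ch x c) - cons_ch x (ins t c).
Proof. by rewrite /ins prism_cons pushs_id. Qed.

(** Both orders of insertion produce the same words: the letter that ends up further right has its
    position shifted by one when it is inserted first, which changes the sign. *)
Lemma ins_anticomm g h c : ins g (ins h c) = - ins h (ins g c).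
Proof.
apply/eqP; rewrite -addr_eq0; apply/eqP.
apply: (bar_ext (f := (ins g \o ins h) \+ (ins h \o ins g)) (g := \0)).
  by rewrite /= !ins_nil !ins_cons !ins_nil; chain_ring.
move=> x s /= /eqP; rewrite addr_eq0 => /eqP IHs.
rewrite !ins_cons !insB !ins_cons IHs !cons_chB.
have -> : cons_ch x (- ins h (ins g << s >>)) =
    - cons_ch x (ins h (ins g << s >>)) by exact: linearN.
by chain_ring.
Qed.

Section Central.
Hypothesis mulC : forall x y : G, (x * y = y * x)%g.

Lemma ins_inner_bd t c : inner_bd (ins t c) + ins t (inner_bd c) = c.
Proof. by rewrite prism_inner_bd ?pushs_id. Qed.

(** Conjugation by [t] is trivial, so the prism is a homotopy from the identity to itself. *)
Lemma ins_bd t c : bd (ins t c) = - ins t (bd c).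
Proof. by apply/eqP; rewrite -addr_eq0 prism_bd // subrr. Qed.

End Central.
End Insertion.

Lemma pushs_ins (G H : groupType) (f : G -> H) t (c : bar G) :
  pushs f (ins t c) = ins (f t) (pushs f c).
Proof.
apply: (bar_ext (f := pushs f \o ins t) (g := ins (f t) \o pushs f)).
  by rewrite /= ins_nil pushs_nil ins_nil pushs_cons pushs_nil.
move=> x s /= IHs.
by rewrite ins_cons pushsB !pushs_cons ins_cons IHs.
Qed.

(* The shuffle product with the 2-chain [g|h], which has boundary
   [h] - [gh] + [g]. *)
Fixpoint ins2_seq (G : groupType) (g h : G) (s : seq G) : bar G :=
  cons_ch g (ins h << s >>) +
  if s is x :: s' then cons_ch x (ins2_seq g h s') else 0.

HB.lock Definition ins2 (G : groupType) (g h : G) : bar G -> bar G :=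
  linext (ins2_seq g h).
Fact ins2_linear (G : groupType) (g h : G) : linear (ins2 g h).
Proof. by rewrite ins2.unlock; exact: linext_is_linear. Qed.
HB.instance Definition _ (G : groupType) (g h : G) :=
  GRing.isLinear.Build rat (bar G) (bar G) *:%R (ins2 g h)
    (ins2_linear g h).

Section Additivity.
Variable G : groupType.
Hypothesis mulC : forall x y : G, (x * y = y * x)%g.
Variables g h : G.
Implicit Types (x : G) (c : bar G).

Lemma ins2B : {morph ins2 g h : c d / c - d}.
Proof. exact: linearB. Qed.

Lemma ins2_nil : ins2 g h << [::] >> = cons_ch g (ins h << [::] >>).
Proof. by rewrite ins2.unlock linextU /= addr0. Qed.

Lemma ins2_cons x c : ins2 g h (cons_ch x c) =
  cons_ch g (ins h (cons_ch x c)) + cons_ch x (ins2 g h c).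
Proof.
apply: (malg_lin_ext (f := ins2 g h \o cons_ch x)
  (g := (cons_ch g \o ins h \o cons_ch x) \+ (cons_ch x \o ins2 g h))) => s.
by rewrite /= cons_chU ins2.unlock !linextU.
Qed.

Lemma ins2_tail c : tail_ch (ins2 g h c) - ins2 g h (tail_ch c) = ins h c.
Proof.
apply: (bar_ext (f := (@tail_ch G \o ins2 g h) \- (ins2 g h \o @tail_ch G))
  (g := ins h)) => [|x s _] /=.
  by rewrite ins2_nil tail_cons tail_nil linear0 subr0.
by rewrite ins2_cons linearD /= !tail_cons addrK.
Qed.

Lemma ins2_mul_head x c : ins2 g h (mul_head x c) = mul_head x (ins2 g h c) +
  cons_ch g (ins h (mul_head x c)) - cons_ch (x * g)%g (ins h c).
Proof.
apply: (bar_ext (f := ins2 g h \o mul_head x) (g := (mul_head x \o ins2 g h) \+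
  (cons_ch g \o ins h \o mul_head x) \- (cons_ch (x * g)%g \o ins h))).
  by rewrite /= mul_head_nil ins2_nil mul_head_cons addrAC subrr add0r.
move=> y s _ /=; rewrite mul_head_cons !ins2_cons linearD /= !mul_head_cons.
by chain_ring.
Qed.

Lemma ins2_inner_bd c : inner_bd (ins2 g h c) - ins2 g h (inner_bd c) =
  ins (g * h)%g c - ins g c.
Proof.
apply: (bar_ext (f := (@inner_bd G \o ins2 g h) \- (ins2 g h \o @inner_bd G))
  (g := ins (g * h)%g \- ins g)) => [|x s] /=.
  rewrite inner_bd_nil linear0 ins2_nil inner_bd_cons !ins_nil mul_head_cons.
  rewrite inner_bd_cons inner_bd_nil.
  by rewrite mul_head_nil cons_chB !linear0; chain_ring.
move=> IHs; rewrite ins2_cons linearD /= !inner_bd_cons ins2B.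
rewrite ins2_mul_head ins2_cons.
have -> : inner_bd (ins h (cons_ch x << s >>)) =
    cons_ch x << s >> - ins h (inner_bd (cons_ch x << s >>)).
  exact: canRL (addrK _) (ins_inner_bd mulC h _).
rewrite inner_bd_cons insB !ins_cons mul_headB !mul_head_cons cons_chB cons_chB.
have -> : inner_bd (ins2 g h << s >>) =
  ins2 g h (inner_bd << s >>) + (ins (g * h)%g << s >> - ins g << s >>).
  by rewrite -IHs addrC subrK.
rewrite (mulC x g) [cons_ch x (_ + _)]cons_chD !cons_chB.
by chain_ring.
Qed.

(** On cycles this makes insertion additive in the inserted element up to boundaries. It serves for
    the products [1 * 1] and [g * g^-1]. *)
Lemma ins_mul_bd c : bd (ins2 g h c) - ins2 g h (bd c) =
  ins h c - (ins (g * h)%g c - ins g c).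
Proof. by rewrite -ins2_tail -ins2_inner_bd !bdE ins2B; chain_ring. Qed.

End Additivity.

(** * Contraction of the bar complex of the trivial group *)

Definition nil_part (G : groupType) : bar G -> bar G :=
  linext (fun s => (s == [::])%:R *: << [::] >>).
HB.instance Definition _ (G : groupType) :=
  GRing.isLinear.Build rat (bar G) (bar G) *:%R (@nil_part G)
    (linext_is_linear _).

Lemma nil_partE (G : groupType) (c : bar G) :
  exists a, nil_part c = a *: << [::] >>.
Proof.
exists (\sum_(s <- msupp c) c@_s * (s == [::])%:R).
rewrite /nil_part /linext scaler_suml; apply: eq_bigr => s _.
by rewrite scalerA.
Qed.

(** When all letters are [1], the two [inner_bd] terms cancel. What remains puts [1] in front of the
    tail, which restores every nonempty word. *)
Lemma const_bd (G : groupType) (c : bar G) :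
  bd (cons_ch 1%g (pushs (fun=> 1%g) c)) +
  cons_ch 1%g (pushs (fun=> 1%g) (bd c)) =
  pushs (fun=> 1%g) c - nil_part c :> bar G.
Proof.
pose p : bar G -> bar G := pushs (fun=> 1%g).
have pM : {morph (fun=> 1%g) : x y / (x * y)%g : G >-> (x * y)%g : G}.
  by move=> x y; rewrite mulg1.
have pbd d : p (inner_bd d) = inner_bd (p d) by exact: pushs_inner_bd.
rewrite bd_cons mul_head1 subrr add0r; apply: (bar_ext
  (f := (cons_ch 1%g \o @inner_bd G \o pushs (fun=> 1%g)) \+
        (cons_ch 1%g \o pushs (fun=> 1%g) \o @bd G))
  (g := pushs (fun=> 1%g) \- @nil_part G)) => [|x s _] /=.
  rewrite pushs_nil inner_bd_nil bd_nil !linear0 addr0 /nil_part linextU eqxx.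
  by rewrite scale1r subrr.
have -> : nil_part (cons_ch x << s >>) = 0.
  by rewrite cons_chU /nil_part linextU scale0r.
rewrite bd_cons linearD /= pushsB (pushs_mul_head pM) !pushs_cons mul_head1.
rewrite inner_bd_cons mul_head1 -[pushs _ (inner_bd _)]/(p _) pbd /p subrr.
by rewrite add0r subr0 cons_chB subrK.
Qed.

(** * Splitting off an infinite cyclic factor *)

Section IntegerPowers.
Variable G : groupType.
Implicit Types (x : G) (m n : int).

Definition zpow x n : G :=
  match n with Posz k => (x ^+ k)%g | Negz k => ((x ^+ k.+1)^-1)%g end.

Lemma zpow1 x : zpow x 1 = x. Proof. exact: expg1. Qed.

Lemma zpowS x n : zpow x (n + 1) = (zpow x n * x)%g.
Proof.
case: n => [k|[|k]].
- by rewrite -PoszD addn1 /= expgSr.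
- by rewrite NegzE addNr /= expg1 mulVg.
have -> : Negz k.+1 + 1 = Negz k by lia.
by rewrite /zpow (expgS x k.+1) invgM mulgVK.
Qed.

(** The step is an equivalence, so one argument serves both signs; for identities in a group the
    converse is cancellation. *)
Lemma int_step_ind (P : int -> Prop) :
  P 0 -> (forall n, P n <-> P (n + 1)) -> forall n, P n.
Proof.
move=> P0 PS; case=> k.
  by elim: k => [//|k IHk]; rewrite -addn1 PoszD -PS.
elim: k => [|k IHk]; rewrite PS; first by rewrite NegzE addNr.
by have -> : Negz k.+1 + 1 = Negz k by lia.
Qed.

Lemma zpowD x m n : zpow x (m + n) = (zpow x m * zpow x n)%g.
Proof.
elim/int_step_ind: n => [|n]; first by rewrite addr0 mulg1.
by rewrite addrA !zpowS mulgA; split=> [->|/mulIg].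
Qed.

Lemma zpowN x n : zpow x (- n) = ((zpow x n)^-1)%g.
Proof. by apply/esym/mulg1_eq; rewrite -zpowD subrr. Qed.

End IntegerPowers.

Lemma zpow_morph (G H : groupType) (f : G -> H) (x : G) n :
  {morph f : y z / (y * z)%g} -> f (zpow x n) = zpow (f x) n.
Proof.
move=> fM; elim/int_step_ind: n => [|n].
  by apply: (mulgI (f 1%g)); rewrite -fM !mulg1.
by rewrite !zpowS fM; split=> [->|/mulIg].
Qed.

(* The sum of [f j] over [0 <= j < n], with the usual sign convention
   [sum_(n <= j < 0) = - sum_(0 <= j < n)] for negative [n]. *)
Definition zsum (V : zmodType) (f : int -> V) (n : int) : V :=
  match n with
  | Posz k => \sum_(j < k) f j%:Z
  | Negz k => - \sum_(j < k.+1) f (Negz j)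
  end.

Section SignedSums.
Variable V : zmodType.
Implicit Types (f g : int -> V) (m n : int).

Lemma zsum0 f : zsum f 0 = 0. Proof. exact: big_ord0. Qed.

Lemma zsumS f n : zsum f (n + 1) = zsum f n + f n.
Proof.
case: n => [k|[|k]].
- by rewrite -PoszD addn1 /zsum big_ord_recr.
- by rewrite -[Negz 0 + 1]/(0 : int) zsum0 /= big_ord1 addNr.
have -> : Negz k.+1 + 1 = Negz k by lia.
by rewrite /zsum (big_ord_recr k.+1) opprD subrK.
Qed.

Lemma zsumD f m n : zsum f (m + n) = zsum f n + zsum (fun j => f (j + n)) m.
Proof.
elim/int_step_ind: m => [|m]; first by rewrite add0r zsum0 addr0.
rewrite addrAC !zsumS addrA; split=> [->//|/addIr//].
Qed.

Lemma zsum_eq f g n : f =1 g -> zsum f n = zsum g n.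
Proof. by move=> fg; case: n => k /=; congr (- _) || idtac; apply: eq_bigr. Qed.

Lemma zsum_add f g n : zsum (fun j => f j + g j) n = zsum f n + zsum g n.
Proof. by case: n => k; rewrite /= big_split ?opprD. Qed.

Lemma zsum_opp f n : zsum (fun j => - f j) n = - zsum f n.
Proof. by case: n => k; rewrite /= sumrN. Qed.

Lemma zsum_telescope f n : zsum (fun j => f (j + 1) - f j) n = f n - f 0.
Proof.
elim/int_step_ind: n => [|n]; first by rewrite zsum0 subrr.
rewrite zsumS (_ : f (n + 1) - f 0 = f n - f 0 + (f (n + 1) - f n)).
  by split=> [->//|/addIr].
by rewrite [RHS]addrC addrA subrK.
Qed.

Lemma zsum_const (v : V) n : zsum (fun=> v) n = v *~ n.
Proof.
elim/int_step_ind: n => [|n]; first by rewrite zsum0 mulr0z.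
by rewrite zsumS mulrzDr; split=> [->//|/addIr].
Qed.

Lemma zsum_raddf (W : zmodType) (u : {additive V -> W}) f n :
  u (zsum f n) = zsum (fun j => u (f j)) n.
Proof. by case: n => k; rewrite /= ?raddfN raddf_sum. Qed.

End SignedSums.

Lemma zsum_linear (V W : lmodType rat) (u : int -> {linear V -> W}) n :
  linear (fun v => zsum (fun j => u j v) n).
Proof.
move=> a v w; rewrite -[a *: _]/( *:%R a _) zsum_raddf -zsum_add.
by apply: zsum_eq => j; rewrite linearP.
Qed.

(* [G] is the product of the cyclic group generated by [t] and of the kernel of
   [q].  The cover of [BG] with group the kernel of [q] has the integers as
   vertices and simplices [n; g_1|...|g_k], where [n] is the initial vertex.
   The chain homotopy [contr n] contracts it to the kernel along powers of [t];
   [sweep n] contracts the cylinder of [t] over the interval from [0] to [n]. *)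
Section Splitting.
Variable G : groupType.
Hypothesis mulC : forall x y : G, (x * y = y * x)%g.
Variables (t : G) (q : G -> int).
Hypotheses (qM : {morph q : x y / (x * y)%g >-> x + y}) (qt : q t = 1).
Implicit Types (x y g : G) (m n j : int) (s : seq G) (c d : bar G).

Definition kerproj x : G := (x * zpow t (- q x))%g.
Local Notation pi := kerproj.

Lemma kerprojM : {morph pi : x y / (x * y)%g}.
Proof.
move=> x y; rewrite /pi qM opprD zpowD !mulgA; congr (_ * _)%g.
by rewrite -!mulgA; congr (_ * _)%g; rewrite mulC.
Qed.

Lemma kerproj_gen : pi t = 1%g.
Proof. by rewrite /pi qt zpowN zpow1 mulgV. Qed.

Fixpoint contr_seq n s : bar G :=
  if s is x :: s' then
    << zpow t (- n) :: map pi s >> - cons_ch x (contr_seq (n + q x) s')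
  else << [:: zpow t (- n)] >>.

Definition contr n : bar G -> bar G := linext (contr_seq n).
HB.instance Definition _ n :=
  GRing.isLinear.Build rat (bar G) (bar G) *:%R (contr n)
    (linext_is_linear _).

Lemma contrB n : {morph contr n : c d / c - d}.
Proof. exact: linearB. Qed.

Lemma contr_nil n :
  contr n << [::] >> = cons_ch (zpow t (- n)) << [::] >>.
Proof. by rewrite /contr linextU cons_chU. Qed.

Lemma contr_cons n x c : contr n (cons_ch x c) =
  cons_ch (zpow t (- n)) (cons_ch (pi x) (pushs pi c)) -
  cons_ch x (contr (n + q x) c).
Proof.
move: c; apply: (malg_lin_ext (f := contr n \o cons_ch x)
  (g := (cons_ch (zpow t (- n)) \o cons_ch (pi x) \o pushs pi) \-
        (cons_ch x \o contr (n + q x)))) => s.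
by rewrite /= cons_chU /contr !linextU pushsU !cons_chU.
Qed.

Lemma contr_mul_head n x c :
  contr n (mul_head x c) = mul_head x (contr (n + q x) c) +
  cons_ch (zpow t (- n)) (mul_head (pi x) (pushs pi c)) -
  cons_ch (zpow t (- n) * pi x)%g (pushs pi c).
Proof.
(* Naturality of the powers [t^-n] along the edge [x] from [n] to [n + q x]; it plays the role of
   [afE] for the prism. *)
have tE : (x * zpow t (- (n + q x)) = zpow t (- n) * pi x)%g.
  by rewrite /kerproj opprD zpowD !mulgA (mulC x (zpow t (- n))).
move: c; apply: (bar_ext (f := contr n \o mul_head x)
  (g := (mul_head x \o contr (n + q x)) \+
  (cons_ch (zpow t (- n)) \o mul_head (pi x) \o pushs pi) \-
  (cons_ch (zpow t (- n) * pi x)%g \o pushs pi))) => [|y s _] /=.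
  rewrite mul_head_nil pushs_nil mul_head_nil !contr_nil mul_head_cons tE.
  by chain_ring.
rewrite mul_head_cons !contr_cons !pushs_cons mul_headB !mul_head_cons.
rewrite kerprojM tE qM addrA.
by chain_ring.
Qed.

Lemma contr_inner_bd n c : inner_bd (contr n c) + contr n (inner_bd c) = c.
Proof.
(* The vertex must be general, since the recursion moves it to [m + q x]. *)
suff H m : (@inner_bd G \o contr m) \+ (contr m \o @inner_bd G) =1 idfun.
  exact: H.
apply: malg_lin_ext => s; elim: s m => [|x s IHs] m /=.
  rewrite contr_nil inner_bd_cons !inner_bd_nil !linear0 mul_head_nil.
  by rewrite !addr0.
have /= {}IHs := IHs (m + q x).
rewrite -cons_chU contr_cons inner_bdB !inner_bd_cons contrB contr_mul_head.
rewrite contr_cons mul_head_cons -(pushs_inner_bd kerprojM).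
have -> : contr (m + q x) (inner_bd << s >>) =
    << s >> - inner_bd (contr (m + q x) << s >>).
  by rewrite -[X in X - _]IHs addrAC subrr add0r.
rewrite !cons_chB.
by chain_ring.
Qed.

(** The contraction of the first face in the cover: dropping [x] moves the initial vertex from [n]
    to [n + q x]. *)
Definition contr_tail n : bar G -> bar G :=
  linext (fun s => if s is x :: s' then contr (n + q x) << s' >> else 0).
HB.instance Definition _ n :=
  GRing.isLinear.Build rat (bar G) (bar G) *:%R (contr_tail n)
    (linext_is_linear _).

Lemma contr_tail_nil n : contr_tail n << [::] >> = 0.
Proof. exact: linextU. Qed.

Lemma contr_tail_cons n x c :
  contr_tail n (cons_ch x c) = contr (n + q x) c.
Proof.
move: c; apply: (malg_lin_ext (f := contr_tail n \o cons_ch x)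
  (g := contr (n + q x))).
by move=> s; rewrite /= cons_chU /contr_tail linextU.
Qed.

Lemma tail_contr n c : tail_ch (contr n c) = pushs pi c - contr_tail n c.
Proof.
move: c; apply: (bar_ext (f := @tail_ch G \o contr n)
  (g := pushs pi \- contr_tail n)) => [|x s _] /=.
  by rewrite contr_nil tail_cons pushs_nil contr_tail_nil subr0.
by rewrite contr_cons tailB !tail_cons pushs_cons contr_tail_cons.
Qed.

Lemma bd_contr n c :
  bd (contr n c) = pushs pi c - c - contr_tail n c + contr n (inner_bd c).
Proof.
rewrite bdE tail_contr.
have -> : inner_bd (contr n c) = c - contr n (inner_bd c).
  exact: canRL (addrK _) (contr_inner_bd n c).
by chain_ring.
Qed.

Definition contr_ins n : bar G -> bar G :=
  linext (fun s =>
    if s is x :: s' then contr (n + q x) (ins t << s' >>) else 0).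
HB.instance Definition _ n :=
  GRing.isLinear.Build rat (bar G) (bar G) *:%R (contr_ins n)
    (linext_is_linear _).

Lemma contr_ins_nil n : contr_ins n << [::] >> = 0.
Proof. exact: linextU. Qed.

Lemma contr_ins_cons n x c :
  contr_ins n (cons_ch x c) = contr (n + q x) (ins t c).
Proof.
move: c; apply: (malg_lin_ext (f := contr_ins n \o cons_ch x)
  (g := contr (n + q x) \o ins t)).
by move=> s; rewrite /= cons_chU /contr_ins linextU.
Qed.

(** A [t] inserted in front moves the vertex by [q t = 1]; the insertions behind the first letter
    make up [contr_ins], with the opposite sign. *)
Lemma contr_tail_ins n c :
  contr_tail n (ins t c) = contr (n + 1) c - contr_ins n c.
Proof.
move: c; apply: (bar_ext (f := contr_tail n \o ins t)
  (g := contr (n + 1) \- contr_ins n)) => [|x s _] /=.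
  by rewrite ins_nil contr_tail_cons qt contr_ins_nil subr0.
by rewrite ins_cons linearB /= !contr_tail_cons contr_ins_cons qt.
Qed.

Lemma bd_contr_ins n c : bd (contr n (ins t c)) =
  pushs pi (ins t c) - ins t c - (contr (n + 1) c - contr n c)
  + contr_ins n c - contr n (ins t (inner_bd c)).
Proof.
rewrite bd_contr contr_tail_ins.
have -> : inner_bd (ins t c) = c - ins t (inner_bd c).
  exact: canRL (addrK _) (ins_inner_bd mulC t c).
by rewrite contrB; chain_ring.
Qed.

Definition sweep n c := zsum (fun j => contr j (ins t c)) n.
Fact sweep_is_linear n : linear (sweep n).
Proof. exact: (zsum_linear (fun j => contr j \o ins t)). Qed.
HB.instance Definition _ n :=
  GRing.isLinear.Build rat (bar G) (bar G) *:%R (sweep n)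
    (sweep_is_linear n).

(** Summation telescopes the differences [contr (j + 1) c - contr j c], leaving the contractions at
    the two ends of the interval. *)
Lemma bd_sweep n c : bd (sweep n c) =
  (pushs pi (ins t c) - ins t c) *~ n - (contr n c - contr 0 c) +
  zsum (fun j => contr_ins j c) n - sweep n (inner_bd c).
Proof.
rewrite /sweep zsum_raddf -zsum_const.
rewrite -(zsum_telescope (fun j => contr j c)) -!(zsum_opp, zsum_add).
by apply: zsum_eq => j /=; rewrite bd_contr_ins opprB.
Qed.

(* The slant product with the 1-cocycle [q]. *)
Definition cap : bar G -> bar G :=
  linext (fun s => if s is x :: s' then (q x)%:~R *: << s' >> else 0).
HB.instance Definition _ :=
  GRing.isLinear.Build rat (bar G) (bar G) *:%R cap (linext_is_linear _).

Lemma cap_nil : cap << [::] >> = 0. Proof. exact: linextU. Qed.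

Lemma cap_cons x c : cap (cons_ch x c) = (q x)%:~R *: c.
Proof.
move: c; apply: (malg_lin_ext (f := cap \o cons_ch x)
  (g := (q x)%:~R \*: idfun)).
by move=> s; rewrite /= cons_chU /cap linextU.
Qed.

Let bdZ (a : rat) c : bd (a *: c) = a *: bd c.
Proof. exact: linearZ. Qed.

Lemma cap_bd c : cap (bd c) = - bd (cap c).
Proof.
apply/eqP; rewrite -addr_eq0; apply/eqP.
move: c; apply: (bar_ext (f := (cap \o @bd G) \+ (@bd G \o cap)) (g := \0)).
  by rewrite /= bd_nil cap_nil !linear0 addr0.
move=> g [|x s] _ /=; rewrite bd_cons cap_cons.
  rewrite mul_head_nil inner_bd_nil subrr !linear0 /= bdZ bd_nil scaler0.
  by rewrite !addr0 linear0.
rewrite -cons_chU linearD linearB /= mul_head_cons !cap_cons bdZ.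
by rewrite bdE tail_cons qM intrD; chain_ring.
Qed.

(** In the cover, the tail of a simplex [x :: s] at vertex 0 starts at vertex [q x]; the sweep
    compares the contractions of [s] from [q x] and from 0. *)
Definition sweepq : bar G -> bar G :=
  linext (fun s => if s is x :: s' then sweep (q x) << s' >> else 0).
HB.instance Definition _ :=
  GRing.isLinear.Build rat (bar G) (bar G) *:%R sweepq (linext_is_linear _).

Lemma sweepq_nil : sweepq << [::] >> = 0. Proof. exact: linextU. Qed.

Lemma sweepq_cons x c : sweepq (cons_ch x c) = sweep (q x) c.
Proof.
move: c; apply: (malg_lin_ext (f := sweepq \o cons_ch x) (g := sweep (q x))).
by move=> s; rewrite /= cons_chU /sweepq linextU.
Qed.

(** The last bracket is the defect of [contr 0] as a chain homotopy on [G] itself; up to homotopy it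
    is traded for the two [cap] terms. *)
Lemma sweepq_bd c : bd (sweepq c) + sweepq (bd c) =
  pushs pi (ins t (cap c)) - ins t (cap c)
  - (contr_tail 0 c - contr 0 (tail_ch c)).
Proof.
move: c; apply: (bar_ext (f := (@bd G \o sweepq) \+ (sweepq \o @bd G))
  (g := (pushs pi \o ins t \o cap) \- (ins t \o cap) \-
        (contr_tail 0 \- (contr 0 \o @tail_ch G)))).
  rewrite /= bd_nil cap_nil sweepq_nil contr_tail_nil tail_nil !linear0.
  by rewrite !addr0 subrr.
move=> g s _ /=; rewrite sweepq_cons cap_cons contr_tail_cons tail_cons add0r.
rewrite bd_sweep.
have -> : pushs pi (ins t ((q g)%:~R *: << s >>)) - ins t ((q g)%:~R *: << s >>)
  = (pushs pi (ins t << s >>) - ins t << s >>) *~ q g.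
  have iZ a : ins t (a *: << s >>) = a *: ins t << s >> by exact: linearZ.
  have pZ a d : pushs pi (a *: d) = a *: pushs pi d by exact: linearZ.
  by rewrite iZ pZ -scalerBr scaler_int.
rewrite -[RHS]addr0 -!addrA; congr (_ + (_ + _)); rewrite bd_cons.
case: s => [|x s].
  rewrite mul_head_nil subrr add0r inner_bd_nil !linear0 !addr0.
  have z0 : (fun j => contr_ins j << [::] >>) =1 (fun=> 0 : bar G).
    by move=> j; rewrite contr_ins_nil.
  by rewrite (zsum_eq _ z0) zsum_const mul0rz.
rewrite -cons_chU linearD linearB /= mul_head_cons !sweepq_cons qM.
(* The interval from 0 to [q g + q x] is cut at [q x]; the shifted part is the sum of the
   [contr_ins] terms. *)
rewrite [sweep (q g + q x) _]zsumD.
rewrite (zsum_eq (g := fun j => contr (j + q x) (ins t << s >>))); last first.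
  by move=> j; rewrite contr_ins_cons.
rewrite /sweep.
by chain_ring.
Qed.

(* The Kuenneth decomposition of the homology of [ker q * Z]; the term with
   [ins 1] is a boundary. *)
Lemma splitting_cycle z : bd z = 0 ->
  z = pushs pi z + ins t (cap z) - ins 1%g (pushs pi (cap z))
      + bd (sweepq z - contr 0 z).
Proof.
move=> z0; have tz : tail_ch z = inner_bd z.
  by apply/eqP; rewrite -subr_eq0 -bdE z0.
have E := sweepq_bd z; rewrite z0 linear0 addr0 in E.
have -> : bd (sweepq z - contr 0 z) = bd (sweepq z) - bd (contr 0 z).
  exact: linearB.
rewrite E bd_contr tz pushs_ins kerproj_gen.
by chain_ring.
Qed.

End Splitting.

(** * Composition of induced maps, and bounds on the degree *)

Lemma pushs_comp (G H K : groupType) (f : H -> K) (g : G -> H) (c : bar G) :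
  pushs f (pushs g c) = pushs (f \o g) c.
Proof.
apply: (malg_lin_ext (f := pushs f \o pushs g) (g := pushs (f \o g))) => s /=.
by rewrite !pushsU map_comp.
Qed.

Lemma eq_pushs (G H : groupType) (f g : G -> H) (c : bar G) :
  f =1 g -> pushs f c = pushs g c.
Proof. by move=> /funext ->. Qed.

(** The equation [trunc m z = z] bounds the degree of [z] by [m] without a graded type. The bound is
    kept by [pushs] and lowered by [cap]. *)
Definition trunc (G : groupType) (m : nat) : bar G -> bar G :=
  linext (fun s => if (size s <= m)%N then << s >> else 0).
HB.instance Definition _ (G : groupType) m :=
  GRing.isLinear.Build rat (bar G) (bar G) *:%R (@trunc G m)
    (linext_is_linear _).

Lemma truncU (G : groupType) m (s : seq G) :
  trunc m << s >> = if (size s <= m)%N then << s >> else 0.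
Proof. exact: linextU. Qed.

Lemma trunc_pushs (G H : groupType) (f : G -> H) m (c : bar G) :
  trunc m (pushs f c) = pushs f (trunc m c).
Proof.
move: c; apply: (malg_lin_ext (f := @trunc H m \o pushs f)
  (g := pushs f \o @trunc G m)) => s /=.
rewrite pushsU !truncU size_map; case: ifP => _; first by rewrite pushsU.
by rewrite linear0.
Qed.

Lemma trunc_cap (G : groupType) (q : G -> int) m (c : bar G) :
  trunc m (cap q c) = cap q (trunc m.+1 c).
Proof.
move: c; apply: (malg_lin_ext (f := @trunc G m \o cap q)
  (g := cap q \o @trunc G m.+1)) => -[|x s] /=.
  by rewrite truncU /= cap_nil linear0.
rewrite truncU /= ltnS -cons_chU cap_cons linearZ /= truncU.
by case: ifP => _; rewrite ?cap_cons // scaler0 linear0.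
Qed.

Lemma trunc_0 (G : groupType) (c : bar G) : trunc 0 c = nil_part c.
Proof.
move: c; apply: (malg_lin_ext (f := @trunc G 0) (g := @nil_part G)) => s /=.
rewrite truncU leqn0 size_eq0 /nil_part linextU.
by case: eqP => [->|_]; rewrite ?scale1r ?scale0r.
Qed.

(** * Homology of free abelian groups *)

(** The signed sum of all orderings of the letters, which represents their Pontryagin product. *)
Definition word (G : groupType) (w : seq G) : bar G :=
  foldr (@ins G) << [::] >> w.

Lemma pushs_word (G H : groupType) (f : G -> H) (w : seq G) :
  pushs f (word w) = word (map f w).
Proof. by elim: w => [|x w /= <-]; rewrite ?pushs_nil ?pushs_ins. Qed.

Section Words.
Variable G : groupType.
Hypothesis mulC : forall x y : G, (x * y = y * x)%g.
Implicit Types (g x : G) (w : seq G) (c z : bar G).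

Lemma bd_word w : bd (word w) = 0.
Proof.
elim: w => [|x w IHw] /=; first exact: bd_nil.
by rewrite ins_bd // IHw linear0 oppr0.
Qed.

Lemma ins1_bd z : bd z = 0 -> ins 1%g z = bd (ins2 1%g 1%g z).
Proof.
move=> z0; have := ins_mul_bd mulC 1%g 1%g z.
by rewrite z0 linear0 subr0 mulg1 subrr subr0 => ->.
Qed.

Lemma insV_bd g z : bd z = 0 -> exists b, ins (g^-1)%g z = bd b - ins g z.
Proof.
move=> z0; have := ins_mul_bd mulC g g^-1 z.
rewrite z0 linear0 subr0 mulgV ins1_bd // => E.
exists (ins2 g g^-1 z + ins2 1%g 1%g z).
by rewrite linearD /= E; chain_ring.
Qed.

Lemma ins_ins0 g c : ins g (ins g c) = 0.
Proof.
have /eqP := ins_anticomm g g c; rewrite -addr_eq0 -mulr2n -scaler_nat.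
by rewrite scaler_eq0 => /orP[//|/eqP].
Qed.

Section Generation.
Variables (I : finType) (gen : I -> G) (q : I -> G -> int).
Hypotheses (qM : forall i, {morph q i : x y / (x * y)%g >-> x + y}).
Hypotheses (q_gen : forall i j, q i (gen j) = (i == j)%:R).
Hypothesis q_faithful : forall x, (forall i, q i x = 0) -> x = 1%g.

Let projs (r : seq I) x := foldl (fun y i => kerproj (gen i) (q i) y) x r.

Let q_zpow i j n : q i (zpow (gen j) n) = (i == j)%:R * n.
Proof.
elim/int_step_ind: n => [|n].
  by rewrite mulr0; apply: (addrI (q i 1%g)); rewrite -qM mulg1 addr0.
by rewrite zpowS qM q_gen mulrDr mulr1; split=> [->//|/addIr].
Qed.

Let q_projs r i x : q i (projs r x) = if i \in r then 0 else q i x.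
Proof.
elim: r x => [//|j r IHr] x /=; rewrite IHr in_cons.
case: ifP => _; first by rewrite orbT.
rewrite orbF /kerproj qM q_zpow; case: eqP => [->|_].
  by rewrite mul1r subrr.
by rewrite mul0r addr0.
Qed.

(** [splitting_cycle] is applied to one coordinate after another: the slant product has smaller
    degree, and the projection kills the coordinate. An arbitrary [P] is allowed because the
    induction on the degree changes it. *)
Lemma cycle_generation (P : bar G -> Prop) :
  (forall c d, P c -> P d -> P (c + d)) ->
  (forall (a : rat) c, P c -> P (a *: c)) ->
  (forall c, P (bd c)) -> (forall w : seq I, P (word (map gen w))) ->
  forall m z, trunc m z = z -> bd z = 0 -> P z.
Proof.
move=> PD PZ Pbd Pw m.
elim: m P PD PZ Pbd Pw => [|m IHm] P PD PZ Pbd Pw z zm z0.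
  rewrite -zm trunc_0; have [a ->] := nil_partE z.
  exact: PZ (Pw [::]).
have PN c : P c -> P (- c) by rewrite -scaleN1r; exact: PZ.
suff: P (pushs (projs (enum I)) z).
  move: (enum I) => r; elim: r z zm z0 => [|i r IHr] z zm z0 /=.
    rewrite (@eq_pushs _ _ _ idfun) // ?pushs_id //.
  move=> Pz; have qi1 : q i (gen i) = 1 by rewrite q_gen eqxx.
  rewrite (splitting_cycle mulC (qM i) qi1 z0).
  have kM := kerprojM mulC (gen i) (qM i).
  have cz : bd (cap (q i) z) = 0.
    by apply/eqP; rewrite -oppr_eq0 -cap_bd // z0 linear0.
  apply: (PD) (Pbd _); apply: (PD); last first.
    by rewrite ins1_bd -?pushs_bd ?cz ?linear0 //; exact: PN.
  apply: (PD).
    apply: IHr; rewrite ?trunc_pushs ?zm -?pushs_bd ?z0 ?linear0 //.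
    by rewrite pushs_comp (@eq_pushs _ _ _ (projs (i :: r))).
  (* The slant product is a combination of words up to boundaries; inserting [gen i] preserves this
     form, as it anticommutes with the boundary. *)
  apply: (IHm (fun c => P (ins (gen i) c))) => //.
  - by move=> c d Pc Pd; rewrite linearD; exact: PD.
  - by move=> a c Pc; rewrite linearZ; exact: PZ.
  - by move=> c; rewrite -[ins _ _]opprK -ins_bd //; exact: PN.
  - by move=> w; exact: (Pw (i :: w)).
  by rewrite trunc_cap zm.
(* Once all coordinates are killed, the projection is constant and only degree 0 is left. *)
rewrite (@eq_pushs _ _ _ (fun=> 1%g)); last first.
  by move=> x; apply: q_faithful => i; rewrite q_projs mem_enum.
have := const_bd z; rewrite z0 !linear0 addr0 => /esym/eqP.
rewrite subr_eq => /eqP ->; have [a ->] := nil_partE z.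
by apply: PD (Pbd _) _; exact: PZ (Pw [::]).
Qed.

End Generation.
End Words.

(** * Monomials killed by conjugations *)

Section NullWords.
Variables (G H : groupType) (f : G -> H).
Hypothesis mulC : forall x y : G, (x * y = y * x)%g.
Hypothesis fM : {morph f : x y / (x * y)%g}.
Implicit Types (g h : G) (u v w : seq G) (c d : bar G).

Definition null c := exists b, pushs f c = bd b.

Lemma null0 : null 0. Proof. by exists 0; rewrite !linear0. Qed.

Lemma nullD c d : null c -> null d -> null (c + d).
Proof. by move=> [b cb] [e de]; exists (b + e); rewrite !linearD /= cb de. Qed.

Lemma nullZ (a : rat) c : null c -> null (a *: c).
Proof. by move=> [b cb]; exists (a *: b); rewrite !linearZ /= cb. Qed.

Lemma nullN c : null c -> null (- c).
Proof. by rewrite -scaleN1r; exact: nullZ. Qed.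

Lemma null_bd b : null (bd b).
Proof. by exists (pushs f b); rewrite pushs_bd. Qed.

(** Conjugations yield relations of the form [c = - c], which rational coefficients turn into
    [c = 0]. *)
Lemma null_double c : null (c + c) -> null c.
Proof.
move/(nullZ (2%:R^-1)); rewrite -mulr2n -scaler_nat scalerA mulVf //.
by rewrite scale1r.
Qed.

Lemma word_swap g h w : word (g :: h :: w) = - word (h :: g :: w).
Proof. exact: ins_anticomm. Qed.

Lemma null_swap g h w : null (word (h :: g :: w)) -> null (word (g :: h :: w)).
Proof. by rewrite (word_swap g); exact: nullN. Qed.

Lemma word_move u g w :
  word (u ++ g :: w) = (-1) ^+ size u *: word (g :: u ++ w).
Proof.
elim: u => [|h u IHu]; first by rewrite scale1r.
rewrite [LHS]/= IHu linearZ /= -[ins h (ins g _)]/(word (h :: g :: u ++ w)).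
by rewrite word_swap scalerN exprS mulN1r scaleNr.
Qed.

Lemma null_move v u g w :
  null (word (v ++ g :: u ++ w)) -> null (word (v ++ u ++ g :: w)).
Proof.
have -> : word (v ++ u ++ g :: w) = (-1) ^+ size u *: word (v ++ g :: u ++ w).
  elim: v => [|h v IHv] /=; first exact: word_move.
  by rewrite IHv linearZ.
exact: nullZ.
Qed.

Lemma null_repeat v u g w : null (word (v ++ g :: u ++ g :: w)).
Proof.
rewrite -cat_rcons; apply: null_move; rewrite cat_rcons.
have -> : word (v ++ g :: g :: u ++ w) = 0; last exact: null0.
elim: v => [|h v IHv] /=; first exact: ins_ins0.
by rewrite IHv linear0.
Qed.

Lemma null_inv g w : null (word ((g^-1)%g :: w) + word (g :: w)).
Proof.
have [b bE] := insV_bd mulC g (bd_word mulC w).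
by rewrite /= bE subrK; exact: null_bd.
Qed.

Definition carries (a : H) g h := (a * f g = f h * a)%g.

(* Conjugation by [a] is homotopic to the identity on the bar complex. *)
Lemma null_carries a u v :
  all2 (fun g h => `[< carries a g h >]) u v -> null (word v - word u).
Proof.
pose f' g := (a^-1 * f g * a)%g.
have f'M : {morph f' : x y / (x * y)%g}.
  by move=> x y; rewrite /f' fM !mulgA mulgK.
move=> uv; have fuv : map f u = map f' v.
  elim: u v uv => [|g u IHu] [|h v] //= /andP[/asboolP gh /IHu ->].
  by rewrite /f' -mulgA -gh mulKg.
have af x : (f x * a = a * f' x)%g by rewrite /f' -mulgA mulVKg.
(* Since [map f' v = map f u], the homotopy on the cycle [word v] joins the images of the two
   words. *)
have := prism_bd fM f'M af (word v).
rewrite (bd_word mulC) linear0 addr0 !pushs_word -fuv => E.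
exists (- prism f f' a (word v)).
by rewrite linearB linearN /= !pushs_word E opprB.
Qed.

(** * Words in letters that conjugations permute and invert *)

Section Letters.
Variables (J : eqType) (L R : J -> G).
Hypothesis flip : forall i, exists a,
  [/\ carries a (L i) (R i)^-1%g, carries a (R i) (L i)^-1%g &
      forall j, j != i -> carries a (L j) (L j) /\ carries a (R j) (R j)].
Hypothesis swap : forall i j, i != j -> exists a,
  [/\ carries a (L i) (L j), carries a (L j) (L i) &
      forall k, k != i -> k != j ->
        carries a (L k) (L k) /\ carries a (R k) (R k)].
Hypothesis invert : exists a, forall i,
  carries a (L i) (L i)^-1%g /\ carries a (R i) (R i)^-1%g.

Definition letter (l : J * bool) := if l.2 then R l.1 else L l.1.
Local Notation lword w := (word (map letter w)).

Lemma null_mem l r : l \in r -> null (lword (l :: r)).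
Proof.
by case/splitPr => u w; rewrite map_cons map_cat; exact: (@null_repeat [::]).
Qed.

Lemma fixed_word a i r : i \notin map fst r ->
  (forall j, j != i -> carries a (L j) (L j) /\ carries a (R j) (R j)) ->
  all2 (fun g h => `[< carries a g h >]) (map letter r) (map letter r).
Proof.
move=> + aj; elim: r => [//|[j b] r IHr] /=; rewrite in_cons negb_or eq_sym.
case/andP => ji /IHr ->; rewrite andbT; apply/asboolP.
by have [? ?] := aj j ji; case: b.
Qed.

Lemma null_flip_pair i r : i \notin map fst r ->
  null (word (L i :: R i :: map letter r)).
Proof.
move=> ir; have [a [aL aR aj]] := flip i.
set c := word _; set A := word ((R i)^-1%g :: (L i)^-1%g :: map letter r).
have H1 : null (A - c).
  apply: (@null_carries a); rewrite /= (fixed_word ir aj) andbT.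
  by apply/andP; split; apply/asboolP.
have H2 := null_inv (R i) ((L i)^-1%g :: map letter r).
have H3 := null_inv (L i) (R i :: map letter r).
apply: null_double.
have := nullD (nullD H2 H3) (nullN H1).
(* After the swap, the mixed terms of [H2] and [H3] cancel and [A] cancels against [H1], leaving
   [c + c]. *)
rewrite [word (R i :: _)]word_swap -/A -/c.
congr null; chain_ring.
Qed.

(** Three letters of one index contain a repetition; without repetition there is just one pair
    [L i], [R i], and [null_flip_pair] applies. *)
Lemma null_same_index l r : l.1 \in map fst r -> null (lword (l :: r)).
Proof.
case: l => i b /= /mapP[[j b'] + /= ij]; rewrite -{j}ij.
case/splitPr => u w; rewrite map_cat map_cons.
apply: (@null_move [:: letter (i, b)]); rewrite /= -map_cat.
set r' := u ++ w; case: (eqVneq b b') => [<-|bb'].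
  by apply: (@null_mem _ ((i, b) :: r')); rewrite inE eqxx.
case: (boolP (i \in map fst r')) => [/mapP[[j c] jr /= ij]|ir].
  move: jr; rewrite -{j}ij; case: (eqVneq c b) => [->|cb] jr.
    by apply: (@null_mem _ ((i, b') :: r')); rewrite inE jr orbT.
  have cb' : c = b' by clear -bb' cb; case: b b' c bb' cb => [] [] [].
  rewrite cb' in jr; apply: null_swap.
  by apply: (@null_mem _ ((i, b) :: r')); rewrite inE jr orbT.
case: b b' bb' => [] [] //= _; last exact: null_flip_pair.
by apply: null_swap; exact: null_flip_pair.
Qed.

Lemma null_flip i r : i \notin map fst r ->
  null (word (L i :: map letter r)) -> null (word (R i :: map letter r)).
Proof.
move=> ir nL; have [a [aL aR aj]] := flip i.
have H1 : null (word ((L i)^-1%g :: map letter r) - word (R i :: map letter r)).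
  apply: (@null_carries a); rewrite /= (fixed_word ir aj) andbT.
  exact/asboolP.
have H2 := null_inv (L i) (map letter r).
have := nullD (nullD H2 (nullN H1)) (nullN nL).
by congr null; chain_ring.
Qed.

Lemma null_swap_pair i j r : i != j -> i \notin map fst r ->
  j \notin map fst r -> null (word (L i :: L j :: map letter r)).
Proof.
move=> ij ir jr; have [a [aij aji ak]] := swap ij.
have H1 : null (word (L j :: L i :: map letter r) -
                word (L i :: L j :: map letter r)).
  apply: (@null_carries a); rewrite /=; apply/andP; split; first exact/asboolP.
  apply/andP; split; first exact/asboolP.
  elim: r ir jr => [//|[k b] r IHr] /=; rewrite !in_cons !negb_or.
  case/andP => ik ir /andP[jk jr]; rewrite IHr // andbT; apply/asboolP.
  rewrite eq_sym in ik; rewrite eq_sym in jk.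
  by have [? ?] := ak k ik jk; case: b.
apply: null_double; move/nullN: H1.
by rewrite [word (L j :: _)]word_swap; congr null; chain_ring.
Qed.

(** In length at least two, the first two letters decide: either one of their indices recurs, or
    both can be made [L]-letters and exchanged. *)
Lemma null_letters (w : seq (J * bool)) : w != [::] -> null (lword w).
Proof.
case: w => [//|[i b] [|[j b'] r]] _.
  have [a /(_ i) [aL aR]] := invert.
  rewrite [map _ _]/=; set g := letter (i, b).
  have H1 : null (word [:: g^-1%g] - word [:: g]).
    by apply: (@null_carries a); rewrite /= andbT /g; apply/asboolP; case: (b).
  have := nullD (null_inv g [::]) (nullN H1).
  by move=> H2; apply: null_double; move: H2; congr null; chain_ring.
case: (boolP (i \in map fst ((j, b') :: r))) => [ir|].
  by apply: null_same_index.
rewrite /= in_cons negb_or => /andP[ij ir].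
have ji : j != i by rewrite eq_sym.
case: (boolP (j \in map fst ((i, b) :: r))) => [jr|].
  by apply: null_swap; apply: (@null_same_index (j, b') ((i, b) :: r)).
rewrite /= in_cons negb_or => /andP[_ jr].
have LL : null (word (L i :: L j :: map letter r)) by exact: null_swap_pair.
have nj : null (word (L i :: letter (j, b') :: map letter r)).
  case: b' => //; apply: null_swap; apply: (@null_flip j ((i, false) :: r)).
    by rewrite /= in_cons negb_or ji.
  exact: null_swap.
case: b => //; apply: (@null_flip i ((j, b') :: r)) => //.
by rewrite /= in_cons negb_or ij.
Qed.

End Letters.
End NullWords.

(** * Comparison with the graded bar complex *)

Fixpoint seq_face (G : groupType) (i : nat) (s : seq G) : seq G :=
  match i, s with
  | 0, _ => behead s
  | _, [::] => [::]
  | 1, x :: s' => mul_head_seq x s'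
  | i'.+1, x :: s' => x :: seq_face i' s'
  end.

Section Comparison.
Variable G : groupType.
Implicit Types (s : seq G).

Lemma inner_bd_faces s :
  inner_bd << s >> =
    \sum_(i < size s) (-1) ^+ i *: << seq_face i.+1 s >> :> bar G.
Proof.
elim: s => [|x s IHs]; first by rewrite inner_bd_nil big_ord0.
rewrite -cons_chU inner_bd_cons mul_headU IHs big_ord_recl expr0 scale1r.
rewrite linear_sum -sumrN.
congr (_ + _); apply: eq_bigr => i _.
by rewrite linearZ /= cons_chU exprS mulN1r scaleNr.
Qed.

Lemma bd_faces k s : size s = k.+1 ->
  bd << s >> = \sum_(i < k.+2) (-1) ^+ i *: << seq_face i s >> :> bar G.
Proof.
case: s => [//|x s] /= [sk]; rewrite big_ord_recl expr0 scale1r bdE.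
rewrite -{1}cons_chU tail_cons inner_bd_faces /= sk -sumrN; congr (_ + _).
by apply: eq_bigr => i _; rewrite exprS mulN1r scaleNr.
Qed.

Lemma size_seq_face k i s : size s = k.+1 -> (i < k.+2)%N ->
  size (seq_face i s) = k.
Proof.
elim: s k i => [//|x s IHs] k [|[|i]] /= [sk] ik //.
  by case: s sk {IHs} => [|y s].
case: k sk ik => [|k] sk ik; first by lia.
by rewrite (IHs k i.+1).
Qed.

Lemma nth_seq_face k i s j : size s = k.+1 -> (i < k.+2)%N -> (j < k)%N ->
  nth 1%g (seq_face i s) j =
    if (j.+1 < i)%N then nth 1%g s j
    else if j.+1 == i then (nth 1%g s j * nth 1%g s j.+1)%g
    else nth 1%g s j.+1.
Proof.
elim: s k i j => [//|x s IHs] k [|[|i]] j /= [sk] ik jk.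
- by [].
- case: s sk {IHs} => [|y s] sk; first by move: jk; rewrite -sk.
  by case: j jk => [|j].
case: j jk => [//|j] jk; case: k sk ik jk => [|k] sk ik jk //=.
by rewrite (IHs k i.+1).
Qed.

Definition ungrade k : chain G k -> bar G :=
  linext (fun g : {ffun 'I_k -> G} => << codom g >>).
HB.instance Definition _ k :=
  GRing.isLinear.Build rat (chain G k) (bar G) *:%R (@ungrade k)
    (linext_is_linear _).

(** The size test ensures that the default value of [nth] is never read. *)
Definition grade k : bar G -> chain G k :=
  linext (fun s => if size s == k then << [ffun i : 'I_k => nth 1%g s i] >>
                   else 0).
HB.instance Definition _ k :=
  GRing.isLinear.Build rat (bar G) (chain G k) *:%R (@grade k)
    (linext_is_linear _).

Lemma nth_codom_ord k (g : {ffun 'I_k -> G}) (i : 'I_k) :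
  nth 1%g (codom g) i = g i.
Proof. by rewrite (nth_map i) ?size_enum_ord // nth_ord_enum. Qed.

Lemma size_codom_ord k (g : {ffun 'I_k -> G}) : size (codom g) = k.
Proof. by rewrite size_codom card_ord. Qed.

Lemma codom_face k i (g : {ffun 'I_k.+1 -> G}) : (i < k.+2)%N ->
  codom (face i g) = seq_face i (codom g).
Proof.
move=> ik; have sg := size_codom_ord g.
apply: (@eq_from_nth _ 1%g).
  by rewrite (size_seq_face sg) // size_codom_ord.
move=> j; rewrite size_codom_ord => jk.
rewrite (nth_seq_face sg) // (nth_codom_ord _ (Ordinal jk)) ffunE /=.
rewrite -(nth_codom_ord _ (widen_ord _ _)) -(nth_codom_ord _ (lift _ _)) /=.
by rewrite /bump leq0n add1n.
Qed.

Lemma bd_ungrade k (c : chain G k.+1) : bd (ungrade c) = ungrade (bdry c).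
Proof.
move: c; apply: (malg_lin_ext (f := @bd G \o @ungrade k.+1)
  (g := @ungrade k \o @bdry G k)) => g /=.
rewrite /bdry linextU {1}/ungrade linextU (bd_faces (size_codom_ord g)).
rewrite linear_sum; apply: eq_bigr => i _.
by rewrite linearZ /= /ungrade linextU codom_face.
Qed.

Lemma bd_ungrade_cycle k (z : cycles G k) : (0 < k)%N ->
  bd (ungrade (val z)) = 0.
Proof.
case: k z => [//|k] z _; rewrite bd_ungrade.
by have /eqP -> := valP z; rewrite linear0.
Qed.

Lemma grade_ungrade j k (c : chain G k) : j != k -> grade j (ungrade c) = 0.
Proof.
move=> jk; move: c; apply: (malg_lin_ext (f := @grade j \o @ungrade k)
  (g := \0)).
move=> g; rewrite /= /ungrade /grade !linextU size_codom_ord.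
by rewrite eq_sym (negPf jk).
Qed.

Lemma ungradeK k (c : chain G k) : grade k (ungrade c) = c.
Proof.
move: c; apply: (malg_lin_ext (f := @grade k \o @ungrade k) (g := idfun)) => g.
rewrite /= /ungrade /grade !linextU size_codom_ord eqxx.
by congr << _ >>; apply/ffunP => i; rewrite ffunE nth_codom_ord.
Qed.

(** A bounding chain of mixed degrees can thus be replaced by its homogeneous component. *)
Lemma grade_bd k (b : bar G) : grade k (bd b) = bdry (grade k.+1 b).
Proof.
move: b; apply: (malg_lin_ext (f := @grade k \o @bd G)
  (g := @bdry G k \o @grade k.+1)) => s /=.
case sE: (size s) => [|m].
  by rewrite (size0nil sE) bd_nil linear0 /grade linextU linear0.
have -> : << s >> = ungrade << [ffun i : 'I_m.+1 => nth 1%g s i] >>.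
  rewrite /ungrade linextU; congr << _ >>.
  apply: (@eq_from_nth _ 1%g); first by rewrite size_codom_ord.
  by move=> i; rewrite sE => im; rewrite (nth_codom_ord _ (Ordinal im)) ffunE.
rewrite bd_ungrade; case: (eqVneq k m) => [->|km]; first by rewrite !ungradeK.
by rewrite !grade_ungrade ?linear0 // eqSS.
Qed.

Lemma trunc_ungrade k (c : chain G k) : trunc k (ungrade c) = ungrade c.
Proof.
move: c; apply: (malg_lin_ext (f := @trunc G k \o @ungrade k)
  (g := @ungrade k)).
by move=> g /=; rewrite /ungrade !linextU truncU size_codom_ord leqnn.
Qed.

End Comparison.

Lemma ungrade_push (G H : groupType) (f : {multiplicative G -> H}) k
    (c : chain G k) :
  ungrade (push f c) = pushs f (ungrade c).
Proof.
move: c; apply: (malg_lin_ext (f := @ungrade H k \o @push G H f k)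
  (g := pushs f \o @ungrade G k)) => g /=.
rewrite /ungrade /push !linextU pushsU /codom /image_mem -map_comp.
by congr << _ >>; apply: eq_map => i /=; rewrite ffunE.
Qed.

(** * The standard free abelian subgroup *)

(* The semidirect product of Z^2 with the exchange of coordinates.  It detects
   exponents: x_n -> (1, 0, false) and x_i -> (0, 0, true) send
   x_n^p x_i x_n^r to (p, r, true). *)
Definition swap_group : Type := (int * int * bool)%type.
HB.instance Definition _ := Choice.on swap_group.

Section SwapGroup.
Implicit Types u v w : swap_group.

Definition swap_one : swap_group := (0, 0, false).
Definition swap_inv u : swap_group :=
  let: (m, n, e) := u in if e then (- n, - m, e) else (- m, - n, e).
Definition swap_mul u v : swap_group :=
  let: (m, n, e) := u in let: (m', n', e') := v in
  if e then (m + n', n + m', ~~ e') else (m + m', n + n', e').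

Fact swap_mulA : associative swap_mul.
Proof.
by move=> [[? ?] []] [[? ?] []] [[? ?] []] /=; rewrite !addrA.
Qed.
Fact swap_mul1 : left_id swap_one swap_mul.
Proof. by move=> [[? ?] ?] /=; rewrite !add0r. Qed.
Fact swap_1mul : right_id swap_one swap_mul.
Proof. by move=> [[? ?] []] /=; rewrite !addr0. Qed.
Fact swap_mulV : left_inverse swap_one swap_inv swap_mul.
Proof. by move=> [[? ?] []] /=; rewrite !addNr. Qed.
Fact swap_Vmul : right_inverse swap_one swap_inv swap_mul.
Proof. by move=> [[? ?] []] /=; rewrite !subrr. Qed.

HB.instance Definition _ := isGroup.Build swap_group
  swap_mulA swap_mul1 swap_1mul swap_mulV swap_Vmul.

Lemma zpow_translation n : zpow ((1, 0, false) : swap_group) n = (n, 0, false).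
Proof.
elim/int_step_ind: n => [//|n]; rewrite zpowS; split=> [->|E].
  by congr (_, _, _); rewrite /= addr0.
apply: (mulIg ((1, 0, false) : swap_group)); rewrite E.
by congr (_, _, _); rewrite /= addr0.
Qed.

End SwapGroup.

(** * Automorphisms of a free group and exponents of the last basis element *)

Section FreeGroup.
Variables (n : nat) (F : groupType) (x : 'I_n.+1 -> F).
Hypothesis Fx : is_free_basis x.
Local Notation xn := (x ord_max).
Local Notation idx := (lift (@ord_max n)).

Lemma idx_max i : (idx i == ord_max) = false.
Proof. by rewrite eq_sym (negPf (neq_lift _ _)). Qed.

Lemma ord_maxP (j : 'I_n.+1) : j = ord_max \/ exists i, j = idx i.
Proof. by case: (unliftP ord_max j) => [i ->|->]; [right; exists i|left]. Qed.

Lemma zpow_sandwich_inj i p r p' r' :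
  (zpow xn p * x (idx i) * zpow xn r =
   zpow xn p' * x (idx i) * zpow xn r')%g -> p = p' /\ r = r'.
Proof.
pose y j : swap_group :=
  if j == ord_max then ((1, 0, false) : swap_group)
  else if j == idx i then ((0, 0, true) : swap_group) else 1%g.
have [f [fy _]] := Fx y; move/(congr1 f).
have fz u m : f (zpow u m) = zpow (f u) m by apply: zpow_morph; exact: gmulfM.
rewrite !gmulfM !fz.
rewrite !fy /y eqxx idx_max eqxx !zpow_translation.
by case; rewrite !addr0 !add0r.
Qed.

Lemma aut_basis_inj (a b : aut F) : (forall j, a (x j) = b (x j)) -> a = b.
Proof. by move=> ab; apply: aut_inj; exact: free_basis_ext ab. Qed.

Lemma autV (a : aut F) u : a (u^-1)%g = ((a u)^-1)%g.
Proof. exact: (mult_morphV a). Qed.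

(** The endomorphism is its own inverse: [e] is constant on the orbits of [s], so applying it twice
    undoes both signs and permutation. *)
Lemma signed_permutation (s : 'I_n.+1 -> 'I_n.+1) (e : pred 'I_n.+1) :
  involutive s -> (forall j, e (s j) = e j) ->
  exists a : aut F,
    forall j, a (x j) = if e j then ((x (s j))^-1)%g else x (s j).
Proof.
move=> sK es; pose y j := if e j then ((x (s j))^-1)%g else x (s j).
have yy (f : {multiplicative F -> F}) : (forall j, f (x j) = y j) ->
    forall j, f (y j) = x j.
  move=> fy j; rewrite /y; case ej: (e j).
    by rewrite mult_morphV fy /y es ej sK invgK.
  by rewrite fy /y es ej sK.
by have [a [aE _]] := free_basis_aut Fx yy yy; exists a.
Qed.

Lemma std_gen (a : aut F) : std_gens x a ->
  exists b : std_abelian x, std_incl x b = a.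
Proof.
move=> ga; have a_in : a \in generated (std_gens x).
  by apply/asboolP => H _; exact.
by exists (exist _ a a_in).
Qed.

Lemma std_lambda i : exists l : std_abelian x,
  is_lambda x (idx i) (std_incl x l).
Proof.
have im : idx i != ord_max by rewrite idx_max.
have [a [la _]] := lambda_unique Fx im.
have [|b bE] := @std_gen a; last by exists b; rewrite bE.
by exists (idx i) => //; left.
Qed.

Lemma std_rho i : exists r : std_abelian x, is_rho x (idx i) (std_incl x r).
Proof.
have im : idx i != ord_max by rewrite idx_max.
have [a [ra _]] := rho_unique Fx im.
have [|b bE] := @std_gen a; last by exists b; rewrite bE.
by exists (idx i) => //; right.
Qed.

(** A shape stable under products and inverses, so that it passes from the generators to the
    generated subgroup. *)
Definition sandwich (a : aut F) : Prop := a xn = xn /\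
  forall i, exists p r, a (x (idx i)) = (zpow xn p * x (idx i) * zpow xn r)%g.

Lemma sandwich_closed : group_closed [pred a | `[< sandwich a >]].
Proof.
split=> [|a b]; rewrite !inE.
  by apply/asboolP; split=> // i; exists 0, 0; rewrite mul1g mulg1.
move=> /asboolP[an ai] /asboolP[bn bi]; apply/asboolP.
have fz (f : aut F) u m : f (zpow u m) = zpow (f u) m.
  by apply: zpow_morph; exact: autM.
have bVn : (b^-1)%g xn = xn by rewrite -[in LHS]bn; exact: autK.
split=> [|i]; first by rewrite -[LHS]/(a ((b^-1)%g xn)) bVn.
have [p [r aE]] := ai i; have [p' [r' bE]] := bi i.
exists (p - p'), (r - r').
have -> : (a / b)%g (x (idx i)) = a ((b^-1)%g (x (idx i))) by [].
have -> : (b^-1)%g (x (idx i)) =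
    (zpow xn (- p') * x (idx i) * zpow xn (- r'))%g.
  apply: (can_inj (autK b)); rewrite [LHS](autVK b) !autM bE.
  rewrite !fz bn.
  by rewrite !mulgA -zpowD addNr mul1g -mulgA -zpowD subrr mulg1.
rewrite !autM aE !fz an.
by rewrite addrC zpowD zpowD !mulgA.
Qed.

Lemma std_sandwich (a : std_abelian x) : sandwich (std_incl x a).
Proof.
have /asboolP/(_ _ sandwich_closed) gen_a := valP a.
apply/asboolP/gen_a => s [j jm [[sj sk]|[sj sk]]]; apply/asboolP; split.
- by rewrite sk // eq_sym.
- move=> i; case: (eqVneq (idx i) j) => [ij|ij].
    by exists 1, 0; rewrite ij sj zpow1 mulg1.
  by exists 0, 0; rewrite sk // mul1g mulg1.
- by rewrite sk // eq_sym.
move=> i; case: (eqVneq (idx i) j) => [ij|ij].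
  by exists 0, 1; rewrite ij sj zpow1 mul1g.
by exists 0, 0; rewrite sk // mul1g mulg1.
Qed.

Lemma std_incl_inj : injective (std_incl x).
Proof. exact: val_inj. Qed.

Lemma std_exponents : exists q : 'I_n * bool -> std_abelian x -> int,
  forall a i, std_incl x a (x (idx i)) =
    (zpow xn (q (i, false) a) * x (idx i) * zpow xn (q (i, true) a))%g.
Proof.
have /choice[q qE] : forall u : 'I_n * std_abelian x, exists pr : int * int,
    std_incl x u.2 (x (idx u.1)) =
    (zpow xn pr.1 * x (idx u.1) * zpow xn pr.2)%g.
  move=> [i a] /=; have [_ /(_ i)[p [r E]]] := std_sandwich a.
  by exists (p, r).
exists (fun l a => if l.2 then (q (l.1, a)).2 else (q (l.1, a)).1).
by move=> a i; exact: (qE (i, a)).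
Qed.

End FreeGroup.

(** * Conjugations of the standard generators, and their dual coordinates *)

Section StandardGenerators.
Variables (n : nat) (F : groupType) (x : 'I_n.+1 -> F).
Hypothesis Fx : is_free_basis x.
Local Notation xn := (x ord_max).
Local Notation idx := (lift (@ord_max n)).
Local Notation incl := (std_incl x).
Variables L R : 'I_n -> std_abelian x.
Hypothesis LP : forall i, is_lambda x (idx i) (incl (L i)).
Hypothesis RP : forall i, is_rho x (idx i) (incl (R i)).

Lemma std_max a : incl a xn = xn.
Proof. by have [] := std_sandwich a. Qed.

Lemma lambdaE i j : incl (L i) (x (idx j)) =
  if i == j then (xn * x (idx j))%g else x (idx j).
Proof.
have [LE Lk] := LP i; case: eqP => [<-//|/eqP ij]; apply: Lk.
by rewrite (inj_eq lift_inj) eq_sym.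
Qed.

Lemma rhoE i j : incl (R i) (x (idx j)) =
  if i == j then (x (idx j) * xn)%g else x (idx j).
Proof.
have [RE Rk] := RP i; case: eqP => [<-//|/eqP ij]; apply: Rk.
by rewrite (inj_eq lift_inj) eq_sym.
Qed.

Lemma aut_std_inj (a b : aut F) :
  a xn = b xn -> (forall j, a (x (idx j)) = b (x (idx j))) -> a = b.
Proof.
move=> abn ab; apply: (aut_basis_inj Fx) => j.
by case: (ord_maxP j) => [->|[i ->]].
Qed.

(** The premise contains no inverse, so it can be checked on the basis. *)
Lemma carriesV (a : aut F) (g h : std_abelian x) :
  (incl h * (a * incl g))%g = a -> carries incl a g (h^-1)%g.
Proof.
move=> E; rewrite /carries mult_morphV; apply: (mulgI (incl h)).
by rewrite E mulVKg.
Qed.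

Lemma std_flip i : exists a : aut F,
  [/\ carries incl a (L i) (R i)^-1%g, carries incl a (R i) (L i)^-1%g &
      forall j, j != i ->
        carries incl a (L j) (L j) /\ carries incl a (R j) (R j)].
Proof.
have [a aE] := @signed_permutation n F x Fx id (pred1 (idx i))
  (fun=> erefl) (fun=> erefl).
have an : a xn = xn by rewrite aE /= eq_sym idx_max.
have ax j : a (x (idx j)) = if j == i then ((x (idx j))^-1)%g else x (idx j).
  by rewrite aE /= (inj_eq lift_inj).
exists a; split.
- apply: carriesV; apply: aut_std_inj => [|j].
    by rewrite -[LHS]/(incl (R i) (a (incl (L i) xn))) std_max an std_max.
  rewrite -[LHS]/(incl (R i) (a (incl (L i) (x (idx j))))) lambdaE ax.
  case: (eqVneq i j) => [<-|ij]; rewrite ?eqxx.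
    by rewrite !autM an ax eqxx autV std_max rhoE eqxx invgM mulVKg.
  by rewrite ax eq_sym (negPf ij) rhoE (negPf ij).
- apply: carriesV; apply: aut_std_inj => [|j].
    by rewrite -[LHS]/(incl (L i) (a (incl (R i) xn))) std_max an std_max.
  rewrite -[LHS]/(incl (L i) (a (incl (R i) (x (idx j))))) rhoE ax.
  case: (eqVneq i j) => [<-|ij]; rewrite ?eqxx.
    by rewrite !autM an ax eqxx autV std_max lambdaE eqxx invgM mulgVK.
  by rewrite ax eq_sym (negPf ij) lambdaE (negPf ij).
move=> j ji; split; apply: aut_std_inj => [|k].
- by rewrite -[LHS]/(a (incl (L j) xn)) -[RHS]/(incl (L j) (a xn)) an std_max.
- rewrite -[LHS]/(a (incl (L j) (x (idx k)))).
  rewrite -[RHS]/(incl (L j) (a (x (idx k)))) lambdaE ax.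
  case: (eqVneq j k) => [<-|jk].
    by rewrite autM an ax (negPf ji) lambdaE eqxx.
  by rewrite ax; case: ifP => _; rewrite ?autV lambdaE (negPf jk).
- by rewrite -[LHS]/(a (incl (R j) xn)) -[RHS]/(incl (R j) (a xn)) an std_max.
rewrite -[LHS]/(a (incl (R j) (x (idx k)))).
rewrite -[RHS]/(incl (R j) (a (x (idx k)))) rhoE ax.
case: (eqVneq j k) => [<-|jk].
  by rewrite autM an ax (negPf ji) rhoE eqxx.
by rewrite ax; case: ifP => _; rewrite ?autV rhoE (negPf jk).
Qed.

Lemma std_swap i j : i != j -> exists a : aut F,
  [/\ carries incl a (L i) (L j), carries incl a (L j) (L i) &
      forall k, k != i -> k != j ->
        carries incl a (L k) (L k) /\ carries incl a (R k) (R k)].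
Proof.
move=> ij; pose s k := if k == idx i then idx j else
  if k == idx j then idx i else k.
have jiF : (idx j == idx i) = false.
  by rewrite (inj_eq lift_inj) eq_sym (negPf ij).
have sK : involutive s.
  move=> k; rewrite /s; case: (eqVneq k (idx i)) => [->|ki].
    by rewrite jiF eqxx.
  case: (eqVneq k (idx j)) => [->|kj]; rewrite ?eqxx //.
  by rewrite (negPf ki) (negPf kj).
have [a aE] := @signed_permutation n F x Fx s pred0 sK (fun=> erefl).
have an : a xn = xn by rewrite aE /= /s ![ord_max == _]eq_sym !idx_max.
have ax k : a (x (idx k)) =
    x (idx (if k == i then j else if k == j then i else k)).
  rewrite aE /= /s !(inj_eq lift_inj).
  by case: ifP => // _; case: ifP.
pose p k := if k == i then j else if k == j then i else k.
have pK : involutive p.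
  move=> k; rewrite /p; case: (eqVneq k i) => [->|ki].
    by rewrite eq_sym (negPf ij) eqxx.
  by case: (eqVneq k j) => [->|kj]; rewrite ?eqxx // (negPf ki) (negPf kj).
have carriesL k : carries incl a (L k) (L (p k)).
  apply: aut_std_inj => [|m].
    by rewrite -[LHS]/(a (incl (L k) xn)) -[RHS]/(incl (L (p k)) (a xn)) an
               !std_max an.
  rewrite -[LHS]/(a (incl (L k) (x (idx m)))).
  rewrite -[RHS]/(incl (L (p k)) (a (x (idx m)))) lambdaE ax lambdaE.
  by rewrite -/(p m) (inj_eq (inv_inj pK)); case: ifP; rewrite ?autM ?an ax.
have carriesR k : carries incl a (R k) (R (p k)).
  apply: aut_std_inj => [|m].
    by rewrite -[LHS]/(a (incl (R k) xn)) -[RHS]/(incl (R (p k)) (a xn)) an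
               !std_max an.
  rewrite -[LHS]/(a (incl (R k) (x (idx m)))).
  rewrite -[RHS]/(incl (R (p k)) (a (x (idx m)))) rhoE ax rhoE.
  by rewrite -/(p m) (inj_eq (inv_inj pK)); case: ifP; rewrite ?autM ?an ax.
exists a; split.
- by have := carriesL i; rewrite /p eqxx.
- by have := carriesL j; rewrite /p eqxx eq_sym (negPf ij).
move=> k ki kj; have := carriesR k; have := carriesL k.
by rewrite /p (negPf ki) (negPf kj).
Qed.

Lemma std_invert : exists a : aut F, forall i,
  carries incl a (L i) (L i)^-1%g /\ carries incl a (R i) (R i)^-1%g.
Proof.
have [a aE] := @signed_permutation n F x Fx id (pred1 ord_max)
  (fun=> erefl) (fun=> erefl).
have an : a xn = (xn^-1)%g by rewrite aE /= eqxx.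
have ax j : a (x (idx j)) = x (idx j) by rewrite aE /= idx_max.
exists a => i; split; apply: carriesV; apply: aut_std_inj => [|j].
- by rewrite -[LHS]/(incl (L i) (a (incl (L i) xn))) std_max an autV std_max.
- rewrite -[LHS]/(incl (L i) (a (incl (L i) (x (idx j))))) lambdaE.
  case: eqP => [<-|/eqP ij]; last by rewrite ax lambdaE (negPf ij).
  by rewrite !autM an ax autV std_max lambdaE eqxx mulKg.
- by rewrite -[LHS]/(incl (R i) (a (incl (R i) xn))) std_max an autV std_max.
rewrite -[LHS]/(incl (R i) (a (incl (R i) (x (idx j))))) rhoE.
case: eqP => [<-|/eqP ij]; last by rewrite ax rhoE (negPf ij).
by rewrite !autM an ax autV std_max rhoE eqxx mulgK.
Qed.

(** Uniqueness of the exponents makes them additive. Together with commutativity, this expresses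
    that the subgroup is free abelian on the generators, in the form used by [cycle_generation]. *)
Lemma std_coordinates : exists q : 'I_n * bool -> std_abelian x -> int,
  [/\ forall l, {morph q l : a b / (a * b)%g >-> a + b},
      forall l m, q l (letter L R m) = (l == m)%:R &
      forall a, (forall l, q l a = 0) -> a = 1%g].
Proof.
have [q qE] := std_exponents x; exists q.
have qU a i p r :
    incl a (x (idx i)) = (zpow xn p * x (idx i) * zpow xn r)%g ->
    q (i, false) a = p /\ q (i, true) a = r.
  by rewrite qE => /(zpow_sandwich_inj Fx).
split.
- move=> [i b] a1 a2; have [] := qU (a1 * a2)%g i
    (q (i, false) a1 + q (i, false) a2) (q (i, true) a1 + q (i, true) a2).
    rewrite -[LHS]/(incl a1 (incl a2 (x (idx i)))) qE !autM qE.
    have fz u m : incl a1 (zpow u m) = zpow (incl a1 u) m.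
      by apply: zpow_morph; exact: autM.
    rewrite !fz std_max [q (i, false) a1 + _]addrC !zpowD.
    by rewrite !mulgA.
  by case: b.
- move=> [i b] [j c]; have [] := qU (letter L R (j, c)) i
    ((i, false) == (j, c))%:R ((i, true) == (j, c))%:R.
    rewrite /letter /= !xpair_eqE; case: c => /=.
      rewrite rhoE eq_sym andbF andbT mul1g; case: eqP => _ //=.
      by rewrite mulg1.
    rewrite lambdaE eq_sym andbF andbT mulg1; case: eqP => _ //=.
    by rewrite mul1g.
  by case: b.
move=> a a0; apply: std_incl_inj; apply: aut_std_inj => [|j].
  by rewrite std_max.
by rewrite qE !a0 mul1g mulg1.
Qed.

(** Additive coordinates do not see the order of factors, so all of them vanish on the quotient of
    [a * b] by [b * a]. *)
Lemma std_commutative (a b : std_abelian x) : (a * b = b * a)%g.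
Proof.
have [q [qM _ q1]] := std_coordinates.
have qV l c : q l (c^-1)%g = - q l c.
  have q1l : q l 1%g = 0 by apply: (addrI (q l 1%g)); rewrite -qM mulg1 addr0.
  by apply/eqP; rewrite -addr_eq0 -qM mulVg q1l.
apply: divg1_eq; apply: q1 => l; rewrite !(qM, qV).
by rewrite [q l b + _]addrC subrr.
Qed.

End StandardGenerators.

Theorem theorem7p1 (n : nat) (F : groupType) (x : 'I_n.+1 -> F)
    (Fx : is_free_basis x) (k : nat) (k_gt0 : (0 < k)%N)
    (h : homology (std_abelian x) k) :
  hmap (std_incl x) h = 0 :> homology (aut F) k.
Proof.
have [L LP] := choice (std_lambda Fx); have [R RP] := choice (std_rho Fx).
have [q [qM q_gen q1]] := std_coordinates Fx LP RP.
have mulC := std_commutative Fx LP RP.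
have inclM : {morph std_incl x : a b / (a * b)%g} by exact: gmulfM.
have [z <-] := hclass_surj h; rewrite hmap_class; apply/eqP.
rewrite hclass_eq0 unfold_in; apply/asboolP.
set c := val z; rewrite -[val _]/(push (std_incl x) c).
have c0 : bd (ungrade c) = 0 by exact: bd_ungrade_cycle.
(* The empty word is also a product of generators, and conjugations do not kill it; its multiples
   are set aside. *)
have [a [b ab]] : exists a : rat,
    null (std_incl x) (ungrade c - a *: << [::] >>).
  pose P (d : bar (std_abelian x)) :=
    exists a : rat, null (std_incl x) (d - a *: << [::] >>).
  apply: (cycle_generation (P := P) mulC qM q_gen q1 _ _ _ _
    (trunc_ungrade c) c0).
  - move=> d e [a da] [b eb]; exists (a + b).
    by rewrite scalerDl opprD addrACA; exact: nullD.
  - move=> a d [b db]; exists (a * b).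
    by rewrite -scalerA -scalerBr; exact: nullZ.
  - by move=> d; exists 0; rewrite scale0r subr0; exact: null_bd.
  move=> [|l w]; first by exists 1; rewrite scale1r subrr; exact: null0.
  exists 0; rewrite scale0r subr0.
  apply: (null_letters mulC inclM) => //.
  - exact: (std_flip Fx LP RP).
  - exact: (std_swap Fx LP RP).
  exact: (std_invert Fx LP RP).
exists (grade k.+1 b).
rewrite -grade_bd -ab pushsB -ungrade_push linearB /= ungradeK.
(* The empty word lives in degree 0, so it disappears from the component of degree [k > 0]. *)
have -> : grade k (pushs (std_incl x) (a *: << [::] >>)) = 0.
  rewrite [pushs _ _]linearZ /= pushs_nil [LHS]linearZ /=.
  by rewrite [grade _ _]linextU /= eq_sym (gtn_eqF k_gt0) scaler0.
by rewrite subr0.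
Qed.
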